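(* Let $\mathcal{L}=\{H_i\}_{i\in I}$ and $\mathcal{E}=\{E_j\}_{j\in J}$ be partitions of $\Omega$ ($I,J$ arbitrary), let $\mathcal{A}_{\mathcal L},\mathcal{A}_{\mathcal E},\mathcal{A}$ be Boolean algebras with $\langle\mathcal L\rangle\subseteq\mathcal A_{\mathcal L}\subseteq\langle\mathcal L\rangle^*$, $\langle\mathcal E\rangle\subseteq\mathcal A_{\mathcal E}\subseteq\langle\mathcal E\rangle^*$, $\langle\mathcal A_{\mathcal L}\cup\mathcal A_{\mathcal E}\rangle\subseteq\mathcal A\subseteq\langle\mathcal A_{\mathcal L}\cup\mathcal A_{\mathcal E}\rangle^*$. Let $\sigma$ be a strategy on $\mathcal A\times\mathcal L$ and $\pi$ a finitely additive probability on $\mathcal A_{\mathcal L}$. Let $\underline P=\min\mathcal P$ be the pointwise lower envelope of the set $\mathcal P$ of full conditional probabilities on $\mathcal A$ extending $\{\pi,\sigma\}$. Then, for every $F|K\in\mathcal A\times\mathcal A^0$, $\underline P(F|K)=1$ when $F\wedge K=K$, and if $F\wedge K\neq K$, then: (i) if $\underline P^{\mathbf j}(K)>0$, then $$\underline P(F|K)=\min\left\{\frac{\underline P^{\mathbf j}(F\wedge K)}{\underline P^{\mathbf j}(F\wedge K)+U^{\mathbf j}(F^c,K)},\ \frac{L^{\mathbf j}(F,K)}{L^{\mathbf j}(F,K)+\overline P^{\mathbf j}(F^c\wedge K)}\right\};$$ (ii) if $\underline P^{\mathbf j}(K)=0$, then $$\underline P(F|K)=\min_{i\in I_2^{F|K}}\frac{\sigma(F\wedge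 K|H_i)}{\sigma(K|H_i)}$$ if $I_2^{F|K}\neq\emptyset=I_3^{F|K}$, $\mathrm{card}\,I_2^{F|K}<\aleph_0$ and $\sigma(K|H_i)>0$ for all $i\in I_2^{F|K}$, and $\underline P(F|K)=0$ otherwise, where $I_1^{F|K}=\{i\in I: H_i\wedge F\wedge K\neq\emptyset=H_i\wedge F^c\wedge K\}$, $I_2^{F|K}=\{i\in I: H_i\wedge F\wedge K\neq\emptyset\neq H_i\wedge F^c\wedge K\}$, $I_3^{F|K}=\{i\in I: H_i\wedge F\wedge K=\emptyset\neq H_i\wedge F^c\wedge K\}$.
   Context: Events are elements of a Boolean algebra with operations $\wedge,\vee,(\cdot)^c$, implication order $\subseteq$, top $\Omega$ and bottom $\emptyset$; $\mathcal A^0=\mathcal A\setminus\{\emptyset\}$. For a set $\mathcal G$ of events, $\langle\mathcal G\rangle$ is the Boolean algebra generated by $\mathcal G$, and $\langle\mathcal G\rangle^*$ is the complete atomic Boolean algebra generated by $\mathcal G$ (the minimal atomic Boolean algebra containing $\mathcal G$ and closed under arbitrary conjunctions and disjunctions). A partition of $\Omega$ is a family of pairwise incompatible non-impossible events with disjunction $\Omega$. The atoms of $\mathcal A$ are the events $H_i\wedge E_j\neq\emptyset$. A conditional event $E|H$ is a pair of events $(E,H)$ with $H\neq\emptyset$. Strategy: a map $\sigma:\mathcal A\times\mathcal L\to[0,1]$ such that for every $H_i\in\mathcal L$: (S1) $\sigma(F|H_i)=1$ for every $F\in\mathcal A$ with $F\wedge H_i=H_i$; (S2) $\sigma(\cdot|H_i)$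 is a finitely additive probability on $\mathcal A$. Full conditional probability (f.c.p.) on $\mathcal A$: a function $P:\mathcal A\times\mathcal A^0\to[0,1]$ with (C1) $P(E|H)=P(E\wedge H|H)$; (C2) $P(\cdot|H)$ is a finitely additive probability on $\mathcal A$ for every $H\in\mathcal A^0$; (C3) $P(E\wedge F|H)=P(E|H)\,P(F|E\wedge H)$ whenever $H,E\wedge H\in\mathcal A^0$, $E,F\in\mathcal A$. It extends $\{\pi,\sigma\}$ if $P(B|\Omega)=\pi(B)$ for $B\in\mathcal A_{\mathcal L}$ and $P(F|H_i)=\sigma(F|H_i)$ for $F\in\mathcal A$, $H_i\in\mathcal L$. Coherence: a function $P:\mathcal G\to[0,1]$ on a set $\mathcal G$ of conditional events is a coherent conditional probability if for every $n\in\mathbb N$, $E_1|H_1,\ldots,E_n|H_n\in\mathcal G$ and real $s_1,\ldots,s_n$, the gain $G=\sum_{j=1}^n s_j(\mathbf 1_{E_j}-P(E_j|H_j))\mathbf 1_{H_j}$ satisfies $\min_{C\subseteq H_0^0}G(C)\le0\le\max_{C\subseteq H_0^0}G(C)$, where $H_0^0=\bigvee_{j=1}^nH_j$ and $C$ ranges over the atoms of $\langle\{E_j,H_j\}_{j=1,\ldots,n}\rangle$ contained in $H_0^0$. Joint probabilities: $\mathcal P^{\mathbf j}$ is the set of finitely additive probabilities $\tilde P^{\mathbf j}$ on $\mathcal A$ such that $\tilde P^{\mathbf j}|_{\mathcal A_{\mathcal L}}=\pi$ and $\{\tilde P^{\mathbf j},\sigma\}$ is a coherent conditional probability on $\mathcal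 A\times(\{\Omega\}\cup\mathcal L)$. Its pointwise envelopes are $\underline P^{\mathbf j}=\min\mathcal P^{\mathbf j}$, $\overline P^{\mathbf j}=\max\mathcal P^{\mathbf j}$ (they are the restrictions to $\mathcal A\times\{\Omega\}$ of $\min\mathcal P$ and $\max\mathcal P$). For $F\in\mathcal A$, $K\in\mathcal A^0$: $$L^{\mathbf j}(F,K)=\min\{\tilde P^{\mathbf j}(F\wedge K):\tilde P^{\mathbf j}\in\mathcal P^{\mathbf j},\ \tilde P^{\mathbf j}(F^c\wedge K)=\overline P^{\mathbf j}(F^c\wedge K)\},$$ $$U^{\mathbf j}(F,K)=\max\{\tilde P^{\mathbf j}(F\wedge K):\tilde P^{\mathbf j}\in\mathcal P^{\mathbf j},\ \tilde P^{\mathbf j}(F^c\wedge K)=\underline P^{\mathbf j}(F^c\wedge K)\}.$$ *)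

(* Defs.v *)
From HB Require Import structures.
From mathcomp Require Export all_boot all_order all_algebra.
From mathcomp Require Export all_classical all_reals.

Set Implicit Arguments.
Unset Strict Implicit.
Unset Printing Implicit Defensive.

Import Order.TTheory GRing.Theory Num.Theory.
Local Open Scope classical_set_scope.
Local Open Scope ring_scope.

(* Events are the elements of an ambient Boolean algebra B; "F /\ K", "F \/ K",
   "F^c", "implies", the sure event and the impossible event are
   F `&` K, F `|` K, ~` F, <=, \top and \bot of order_scope. *)

Section Events.
Context {d : Order.disp_t} {B : ctbDistrLatticeType d}.
Implicit Types (S G X : set B) (x y C E F H K : B).

(* Needed for arbitrary conjunctions and disjunctions to make sense; the
   existence of all infimums follows. *)
Definition complete_events : Prop := forall X, supremums X !=set0.

Definition partition_events (I : Type) (H : I -> B) : Prop :=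
  [/\ forall i, H i != \bot%O,
      forall i j, i <> j -> (H i `&` H j)%O = \bot%O
    & supremums (range H) \top%O].

Definition boolean_subalgebra S : Prop :=
  [/\ S \bot%O, S \top%O,
      forall x, S x -> S (~` x)%O,
      forall x y, S x -> S y -> S (x `&` y)%O
    & forall x y, S x -> S y -> S (x `|` y)%O].

Definition atom S C : Prop :=
  [/\ S C, C != \bot%O
    & forall x, S x -> x != \bot%O -> (x <= C)%O -> x = C].

Definition complete_atomic_subalgebra S : Prop :=
  [/\ boolean_subalgebra S,
      forall X x, X `<=` S -> supremums X x -> S x,
      forall X x, X `<=` S -> infimums X x -> S x
    & forall x, S x -> x != \bot%O -> exists2 C, atom S C & (C <= x)%O].

Definition generated G : set B := smallest boolean_subalgebra G.

Definition generated_star G : set B := smallest complete_atomic_subalgebra G.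

End Events.

Definition has_minimum {R : realType} (S : set R) : Prop :=
  exists2 m, S m & lbound S m.
Definition has_maximum {R : realType} (S : set R) : Prop :=
  exists2 m, S m & ubound S m.

(* A real function on a set of events (resp. of conditional events E|H) is a
   total function B -> R (resp. B -> B -> R, applied to E and then H); only its
   values on the intended domain are ever constrained or used. *)

Section Probabilities.
Context {R : realType} {d : Order.disp_t} {B : ctbDistrLatticeType d}.
Implicit Types (A : set B) (P sigma : B -> B -> R) (p pi : B -> R).
Implicit Types (E F H K C : B).

Definition fin_additive_probability A p : Prop :=
  [/\ forall E, A E -> 0 <= p E,
      p \top%O = 1
    & forall E F, A E -> A F -> (E `&` F)%O = \bot%O ->
        p (E `|` F)%O = p E + p F].

Definition strategy A (I : Type) (H : I -> B) sigma : Prop :=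
  forall i,
    (forall F, A F -> (F `&` H i)%O = H i -> sigma F (H i) = 1) /\
    fin_additive_probability A (fun F => sigma F (H i)).

Definition full_conditional_probability A P : Prop :=
  [/\ forall E H, A E -> A H -> H != \bot%O -> P E H = P (E `&` H)%O H,
      forall H, A H -> H != \bot%O ->
        fin_additive_probability A (fun E => P E H)
    & forall E F H, A E -> A F -> A H -> H != \bot%O ->
        (E `&` H)%O != \bot%O ->
        P (E `&` F)%O H = P E H * P F (E `&` H)%O].

Definition fcp_extensions A (AL : set B) (I : Type) (H : I -> B) pi sigma
    : set (B -> B -> R) :=
  [set P | [/\ full_conditional_probability A P,
      forall E, AL E -> P E \top%O = pi E
    & forall F i, A F -> P F (H i) = sigma F (H i)]].

(* On an atom C of an algebra containing E, the indicator of E is C <= E. *)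
Definition gain P (n : nat) (e : 'I_n -> B * B) (s : 'I_n -> R) C : R :=
  \sum_(j < n) s j * ((C <= (e j).1)%O%:R - P (e j).1 (e j).2)
                   * (C <= (e j).2)%O%:R.

(* The atoms involved are finitely many, so that inf and sup are a minimum and
   a maximum (for n = 0 there is no atom and the condition is 0 <= 0 <= 0). *)
Definition coherent (G : set (B * B)) P : Prop :=
  (forall e, G e -> 0 <= P e.1 e.2 <= 1) /\
  forall (n : nat) (e : 'I_n -> B * B) (s : 'I_n -> R), (forall j, G (e j)) ->
    let H0 := (\join_(j < n) (e j).2)%O in
    let D := generated [set x | exists j, x = (e j).1 \/ x = (e j).2] in
    let gains := [set gain P e s C | C in [set C | atom D C /\ (C <= H0)%O]] in
    inf gains <= 0 <= sup gains.

(* The assessment {p, sigma} is the function P, the values of which on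
   A x ({\top} U L) are prescribed. *)
Definition joint_probabilities A (AL : set B) (I : Type) (H : I -> B) pi sigma
    : set (B -> R) :=
  [set p | [/\ fin_additive_probability A p,
      forall E, AL E -> p E = pi E
    & exists P, [/\ forall F, A F -> P F \top%O = p F,
        forall F i, A F -> P F (H i) = sigma F (H i)
      & coherent (A `*` ([set \top%O] `|` range H)) P]]].

Definition cond_values (PP : set (B -> B -> R)) F K : set R :=
  [set P F K | P in PP].
Definition cond_lower PP F K : R := inf (cond_values PP F K).

Definition values (Pj : set (B -> R)) E : set R := [set p E | p in Pj].
Definition lower Pj E : R := inf (values Pj E).
Definition upper Pj E : R := sup (values Pj E).

Definition L_values Pj F K : set R :=
  [set p (F `&` K)%O | p in
    [set p | Pj p /\ p (~` F `&` K)%O = upper Pj (~` F `&` K)%O]].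
Definition L_joint Pj F K : R := inf (L_values Pj F K).

Definition U_values Pj F K : set R :=
  [set p (F `&` K)%O | p in
    [set p | Pj p /\ p (~` F `&` K)%O = lower Pj (~` F `&` K)%O]].
Definition U_joint Pj F K : R := sup (U_values Pj F K).

Definition index2 (I : Type) (H : I -> B) F K : set I :=
  [set i | (H i `&` F `&` K)%O != \bot%O /\ (H i `&` ~` F `&` K)%O != \bot%O].
Definition index3 (I : Type) (H : I -> B) F K : set I :=
  [set i | (H i `&` F `&` K)%O = \bot%O /\ (H i `&` ~` F `&` K)%O != \bot%O].

End Probabilities.

(* Main.v *)
(** Every event of [A] is a union of atoms [H i `&` E j], so each atom carries a
Dirac probability on [A].  A probability [p] on [A] lies in P^j iff it equals
[pi] on [AL] and [p (F `&` H i) = sigma F (H i) * pi (H i)].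

For disjoint [X] and [Y] in [A], one [p] in P^j minimises [p X] and maximises
[p Y] simultaneously: average over the cells [a] of a finite partition of the
sure event in [AL], with weights [pi a], the charge [sigma(.|H i)] if
[a = H i], and otherwise a Dirac mass at an atom of [a] that lies in [Y] if
possible, and outside [X] failing that; then pass to the limit along an
ultrafilter refining the partitions.  With [X = F `&` K] and
[Y = ~` F `&` K], both expressions in (i) equal
[lower X / (lower X + upper Y)].

A well-ordered list of probabilities on [A] such that every nonzero event is
charged by one of them defines a full conditional probability: condition the
first one that charges [K].  For (ii), start the list with a [p] in P^j that
is null on [K], follow it by a probability with the required value at [F|K]
(a charge [sigma(.|H i)], a Dirac mass, or a limit of Dirac masses in
infinitely many [H i]), and end it with all the charges of the strategy and all
the Dirac masses. *)

Require Import Defs.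
From mathcomp Require Import wochoice topology normedtype ring.
Set Implicit Arguments.
Unset Strict Implicit.
Unset Printing Implicit Defensive.

Import Order.Theory GRing.Theory Num.Theory numFieldNormedType.Exports.
Local Open Scope classical_set_scope.
Local Open Scope ring_scope.

(** * Decided events and generated algebras *)

Ltac meet_proj :=
  first [exact: lexx | apply: leIx2; apply/orP; left; meet_proj
        | apply: leIx2; apply/orP; right; meet_proj].
Ltac meet_le := rewrite ?lexI; repeat (apply/andP; split); meet_proj.
Ltac meet_eq := apply/le_anti/andP; split; meet_le.

Section Decides.
Context {d : Order.disp_t} {B : ctbDistrLatticeType d}.
Implicit Types (x y z : B) (S G : set B).

(** An event that decides a whole algebra acts on it as a point. The two alternatives overlap only
    for [y = \bot]. *)
Definition decides y x : Prop := (y <= x)%O \/ (y `&` x)%O = \bot%O.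

Lemma meet0P x y : ((x `&` y)%O = \bot%O) <-> (x <= ~` y)%O.
Proof. by rewrite -disj_leC; split=> [->|/eqP]. Qed.

Lemma decides_le y z x : (z <= y)%O -> decides y x -> decides z x.
Proof.
move=> zy [yx|/meet0P yx]; [left|right]; first exact: le_trans zy yx.
by apply/meet0P/(le_trans zy yx).
Qed.

Lemma decides_meet x y : decides (y `&` x)%O x.
Proof. by left; meet_le. Qed.

Lemma decides_meetC x y : decides (y `&` ~` x)%O x.
Proof. by right; rewrite -meetA meetCx meetx0. Qed.

Lemma decidesC y x : decides y x -> decides y (~` x)%O.
Proof.
case=> [yx|/meet0P yx]; [right|by left].
by apply/meet0P; rewrite complK.
Qed.

Lemma decides_subalgebra y : boolean_subalgebra [set x | decides y x].
Proof.
have dI x z : decides y x -> decides y z -> decides y (x `&` z)%O.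
  move=> [yx|yx] [yz|yz]; try by right; first [rewrite meetA yx meet0x |
    rewrite meetCA yz meetx0].
  by left; rewrite lexI yx.
split=> //=.
- by right; rewrite meetx0.
- by left; rewrite lex1.
- by move=> x; apply: decidesC.
- move=> x z dx dz; rewrite -[(x `|` z)%O]complK complU.
  by apply/decidesC/dI; apply: decidesC.
Qed.

(** The atoms are the [C w] other than [\bot]. If no member of [X] contains [C w], all of them lie
    below its complement, and so does their supremum; infima follow by complementation. *)
Lemma complete_atomic_decides (W : Type) (C : W -> B) :
  (forall w w', decides (C w) (C w')) ->
  (forall x, x != \bot%O -> exists w, (C w `&` x)%O != \bot%O) ->
  complete_atomic_subalgebra [set x | forall w, decides (C w) x].
Proof.
move=> decC coverC.
have decP w x : decides (C w) x -> (C w `&` x)%O != \bot%O -> (C w <= x)%O.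
  by move=> [//|->]; rewrite eqxx.
have [d0 d1 dC dI dU] : boolean_subalgebra [set x | forall w, decides (C w) x].
  split=> /=.
  - by move=> w; have [] := decides_subalgebra (C w).
  - by move=> w; have [] := decides_subalgebra (C w).
  - by move=> x dx w; have [_ _ + _ _] := decides_subalgebra (C w); apply;
      apply: dx.
  - by move=> x y dx dy w; have [_ _ _ + _] := decides_subalgebra (C w);
      apply; [apply: dx|apply: dy].
  - by move=> x y dx dy w; have [_ _ _ _] := decides_subalgebra (C w); apply;
      [apply: dx|apply: dy].
have d_sup X x : X `<=` [set x | forall w, decides (C w) x] ->
    supremums X x -> forall w, decides (C w) x.
  move=> XD [ubx lubx] w.
  have [[y Xy Cy]|noy] := pselect (exists2 y, X y & (C w <= y)%O).
    by left; apply: le_trans Cy (ubx _ Xy).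
  right; apply/meet0P; rewrite lexC; apply: lubx => y Xy.
  by have [Cy|/meet0P] := XD _ Xy w; [case: noy; exists y|rewrite lexC].
split=> //.
- move=> X x XD [lbx glbx].
  suff /dC : forall w, decides (C w) (~` x)%O by rewrite /= complK.
  apply: (d_sup [set (~` z)%O | z in X]).
    by move=> _ [z Xz <-]; apply: dC; apply: XD.
  split=> [_ [z Xz <-]|y uby]; first by rewrite leC; apply: lbx.
  rewrite -[y]complK leC; apply: glbx => z Xz.
  by rewrite -[z]complK leC; apply: uby; exists z.
- move=> x dx x0; have [w Cwx] := coverC _ x0.
  have Cx := decP _ _ (dx w) Cwx.
  exists (C w) => //; split=> [|/=|y dy y0 yC].
  + by move=> w'; apply: decC.
  + by apply: contra Cwx => /eqP->; rewrite meet0x.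
  + apply/le_anti; rewrite yC /=; apply: decP => //.
    by rewrite (meet_idPr yC).
Qed.

Lemma partition_decides (I : Type) (H : I -> B) i j :
  partition_events H -> decides (H i) (H j).
Proof.
move=> [_ disH _]; have [->|/disH] := pselect (i = j); last by right.
by left; rewrite lexx.
Qed.

(** Otherwise the complement of [x] would bound every [H i] and thus be the sure event. *)
Lemma partition_cover (I : Type) (H : I -> B) x :
  partition_events H -> x != \bot%O -> exists i, (H i `&` x)%O != \bot%O.
Proof.
move=> [_ _ [_ lubH]] x0; apply: contrapT => noi.
have : (\top <= ~` x)%O.
  apply: lubH => _ [i _ <-]; apply/meet0P/eqP.
  by apply: contrapT => /negP Hx; apply: noi; exists i.
by rewrite lexC compl1 lex0 (negPf x0).
Qed.

Lemma generated_subset G S :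
  boolean_subalgebra S -> G `<=` S -> generated G `<=` S.
Proof. by move=> bS GS; apply: smallest_sub. Qed.

Lemma generated_subalgebra G : boolean_subalgebra (generated G).
Proof.
split=> /=.
- by move=> S [[]].
- by move=> S [[]].
- by move=> x Dx S [bS GS]; have [_ _ + _ _] := bS; apply; apply: Dx.
- by move=> x y Dx Dy S [bS GS]; have [_ _ _ + _] := bS; apply;
    [apply: Dx|apply: Dy].
- by move=> x y Dx Dy S [bS GS]; have [_ _ _ _] := bS; apply;
    [apply: Dx|apply: Dy].
Qed.

(** Deciding the generators is enough, as the events decided by [y] form a subalgebra. *)
Lemma atom_generated G y : generated G y -> y != \bot%O ->
  (forall x, G x -> decides y x) -> atom (generated G) y.
Proof.
move=> Gy y0 decy; split=> // x Gx x0 xy.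
have : decides y x.
  apply: (generated_subset (decides_subalgebra y) _ Gx); exact: decy.
move=> [yx|yx]; first by apply/le_anti; rewrite xy.
by move: x0; rewrite -(meet_idPr xy) yx eqxx.
Qed.

End Decides.

Section Constituents.
Context {d : Order.disp_t} {B : ctbDistrLatticeType d}.
Implicit Types (x y z : B) (S : set B).

(** Run through [l], replacing [y] by its part inside the current event unless that part is
    impossible. *)
Lemma constituent_ex S (l : seq B) y : boolean_subalgebra S ->
  (forall x, x \in l -> S x) -> S y -> y != \bot%O ->
  exists C, [/\ S C, C != \bot%O, (C <= y)%O & forall x, x \in l ->
    decides C x].
Proof.
move=> bS; elim: l y => [|z l IH] y Sl Sy y0; first by exists y.
have Sz : S z by apply: Sl; rewrite mem_head.
have {}Sl x : x \in l -> S x by move=> xl; apply: Sl; rewrite in_cons xl orbT.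
suff [C [SC C0 Cy Cl Cz]] : exists C, [/\ S C, C != \bot%O, (C <= y)%O,
    forall x, x \in l -> decides C x & decides C z].
  by exists C; split=> // x; rewrite in_cons => /orP[/eqP->|/Cl].
have [_ _ SN SI _] := bS.
have [yz0|yz0] := eqVneq (y `&` z)%O \bot%O.
  by have [C [SC C0 Cy Cl]] := IH _ Sl Sy y0; exists C; split=> //;
    apply: decides_le Cy _; right.
have [C [SC C0 Cyz Cl]] := IH _ Sl (SI _ _ Sy Sz) yz0.
exists C; split=> //; first exact: le_trans Cyz (leIl _ _).
by left; apply: le_trans Cyz (leIr _ _).
Qed.

End Constituents.

(** * Finitely additive probabilities *)

Section FiniteAdditivity.
Context {R : realType} {d : Order.disp_t} {B : ctbDistrLatticeType d}.
Variables (A : set B).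
Hypothesis bA : boolean_subalgebra A.
Implicit Types (x y z : B) (p : B -> R).

Lemma subalg0 : A \bot%O. Proof. by case: bA. Qed.
Lemma subalg1 : A \top%O. Proof. by case: bA. Qed.
Lemma subalgC x : A x -> A (~` x)%O. Proof. by case: bA => _ _ + _ _;
  exact. Qed.
Lemma subalgI x y : A x -> A y -> A (x `&` y)%O.
Proof. by case: bA => _ _ _ + _; exact. Qed.
Lemma subalgU x y : A x -> A y -> A (x `|` y)%O.
Proof. by case: bA => _ _ _ _; exact. Qed.
#[local] Hint Resolve subalg0 subalg1 subalgC subalgI subalgU : core.

Lemma fap_split p x y : fin_additive_probability A p -> A x -> A y ->
  p x = p (x `&` y)%O + p (x `&` ~` y)%O.
Proof.
move=> [_ _ pD] Ax Ay; rewrite -pD; auto.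
  by rewrite -meetUr joinxC meetx1.
by rewrite meetACA meetxC meetx0.
Qed.

Lemma fap0 p : fin_additive_probability A p -> p \bot%O = 0.
Proof.
move=> pp; have := fap_split pp subalg0 subalg0.
by rewrite !meet0x => /eqP; rewrite -subr_eq0 opprD addNKr oppr_eq0 => /eqP.
Qed.

Lemma fap_ge0 p x : fin_additive_probability A p -> A x -> 0 <= p x.
Proof. by case=> + _ _; exact. Qed.

Lemma fap_le p x y : fin_additive_probability A p -> A x -> A y ->
  (x <= y)%O -> p x <= p y.
Proof.
move=> pp Ax Ay xy; rewrite (fap_split pp Ay Ax) (meet_idPr xy) lerDl.
by apply: fap_ge0; auto.
Qed.

Lemma fap_le1 p x : fin_additive_probability A p -> A x -> p x <= 1.
Proof. by move=> pp Ax; have [_ <- _] := pp; apply: fap_le => //;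
  rewrite ?lex1. Qed.

Lemma fap_null p x y : fin_additive_probability A p -> A x -> A y ->
  (x <= y)%O -> p y = 0 -> p x = 0.
Proof.
move=> pp Ax Ay xy py; apply/le_anti.
by rewrite -{1}py (fap_le pp) // fap_ge0.
Qed.

Lemma fapC p x : fin_additive_probability A p -> A x -> p (~` x)%O = 1 - p x.
Proof.
move=> pp Ax; have [_ <- _] := pp.
by rewrite (fap_split pp subalg1 Ax) !meet1x addrAC subrr add0r.
Qed.

Lemma fap_certain p x y : fin_additive_probability A p -> A x -> A y ->
  p y = 1 -> p (x `&` y)%O = p x.
Proof.
move=> pp Ax Ay py; rewrite [RHS](fap_split pp Ax Ay).
rewrite [X in _ + X](@fap_null _ _ (~` y)%O pp) ?addr0 ?leIr //; auto.
by rewrite fapC // py subrr.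
Qed.

Lemma dirac_fap w : w != \bot%O -> (forall x, A x -> decides w x) ->
  fin_additive_probability A (fun x => (w <= x)%O%:R : R).
Proof.
move=> w0 decw; split=> [x _| |x y Ax Ay xy]; first exact: ler0n.
  by rewrite lex1.
have out z : (w `&` z)%O = \bot%O -> (w <= z)%O = false.
  by move=> wz; apply/negP => /meet_idPl wz'; move: w0; rewrite -wz' wz eqxx.
have [wx|wx] := decw _ Ax.
  have -> : (w <= y)%O = false.
    apply: out; apply/eqP; rewrite -lex0 -xy.
    by rewrite lexI leIr andbT (le_trans (leIl _ _) wx).
  by rewrite wx (le_trans wx (leUl _ _)) addr0.
rewrite [(w <= x)%O]out // add0r; congr (_%:R).
by rewrite !leEmeet meetUr wx join0x.
Qed.

(** By compactness, values in [[0, 1]] converge along an ultrafilter refining [F]; finite additivity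
    and weak inequalities pass to the limit. *)
Lemma ultralimit_fap (T : Type) (F : set_system T) (f : T -> B -> R) :
  ProperFilter F -> (\forall t \near F, fin_additive_probability A (f t)) ->
  exists q, fin_additive_probability A q /\
    forall x c, A x ->
      ((\forall t \near F, f t x <= c) -> q x <= c) /\
      ((\forall t \near F, c <= f t x) -> c <= q x).
Proof.
move=> FF Fp; have [U [UU FU]] := ultraFilterLemma FF.
have Up : \forall t \near U, fin_additive_probability A (f t) by apply: FU.
have cvg_f x : exists l : R, A x -> f t x @[t --> U] --> l.
  have [Ax|nAx] := pselect (A x); last by exists 0.
  have := @segment_compact R 0 1; rewrite compact_ultra /=.
  move=> /(_ ((f^~ x) @ U)).
  have UF : UltraFilter ((f^~ x) @ U).
    have PU := @ultra_proper _ _ UU.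
    split; first exact: fmap_proper_filter.
    move=> G PG UG; apply/seteqP; split=> // S GS.
    have [//|UnS] := in_ultra_setVsetC (f^~ x @^-1` S) UU.
    have /UG GnS : ((f^~ x) @ U) (~` S) by [].
    by have [t []] := filter_ex (filterI GS GnS).
  move=> /(_ UF); case.
    apply: filterS Up => t pt /=.
    by rewrite in_itv /= fap_ge0 // fap_le1.
  by move=> l [_ Ul]; exists l.
have [q cvg_q] := choice cvg_f.
exists q; split.
  split.
  - move=> x Ax; apply: (cvgr_to_ge (cvg_q x Ax)).
    by apply: filterS Up => t pt; apply: fap_ge0.
  - apply: (norm_cvg_unique (cvg_q _ subalg1)).
    by apply: cvg_near_cst; apply: filterS Up => t [].
  - move=> x y Ax Ay xy.
    apply: (norm_cvg_unique (cvg_q _ (subalgU Ax Ay))).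
    apply: cvg_trans (cvgD (cvg_q _ Ax) (cvg_q _ Ay)).
    apply: near_eq_cvg; apply: filterS Up => t [_ _ fD].
    by rewrite fctE fD.
move=> x c Ax; split=> /FU.
  exact: (cvgr_to_le (cvg_q x Ax)).
exact: (cvgr_to_ge (cvg_q x Ax)).
Qed.

End FiniteAdditivity.

(** * Attained extrema of sets of reals *)

Section Attained.
Context {R : realType}.
Implicit Types (S : set R) (m : R).

Lemma inf_attained S m : S m -> lbound S m -> inf S = m.
Proof.
move=> Sm mS; apply/le_anti; rewrite ge_inf //=; last by exists m.
by apply: lb_le_inf => //; exists m.
Qed.

Lemma sup_attained S m : S m -> ubound S m -> sup S = m.
Proof.
move=> Sm mS; apply/le_anti; rewrite ub_le_sup ?andbT //; last by exists m.
by apply: sup_le_ub => //; exists m.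
Qed.

End Attained.

Lemma finite_set_minimum (R : realType) (S : set R) :
  finite_set S -> S !=set0 -> has_minimum S.
Proof.
move=> /finite_seqP[s ->]; elim: s => [[]//|x s IH] _.
have [-> |s0] := eqVneq s [::].
  by exists x => [|y] /=; rewrite ?mem_head // inE => /eqP->.
have [|m ms mmin] := IH.
  by case: s s0 {IH} => // y s _; exists y; rewrite /= mem_head.
exists (Num.min x m); rewrite /= ?in_cons.
  by have [_|_] := leP x m; rewrite ?eqxx // ms orbT.
move=> y /=; rewrite in_cons => /orP[/eqP->|ys]; first by rewrite ge_min lexx.
by rewrite ge_min mmin ?orbT.
Qed.

(** * Full conditional probabilities from layers *)

(** [c S] is the first element of [S], ordered by [rank] and, at equal rank, by a well-ordering of
    [T]. If the first element of [S] lies in a subset, it is first there too; this is the second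
    clause. *)
Lemma ranked_choice (T : Type) (t0 : T) (rank : T -> nat) :
  exists c : set T -> T,
    (forall S, S !=set0 -> S (c S) /\ forall t, S t ->
      (rank (c S) <= rank t)%N) /\
    (forall S S', S' `<=` S -> S' (c S) -> c S' = c S).
Proof.
have [W woW] := well_ordering_principle {classic T}.
pose low (S : set T) := [set t | S t /\ forall u, S u -> (rank t <= rank u)%N].
pose lowest S := [set t : T | low S t /\ forall u, low S u -> W t u].
have lowest_ex S : S !=set0 -> exists2 t, lowest S t &
    forall u, lowest S u -> u = t.
  move=> [s Ss].
  have exn : exists n, `[< exists2 t, S t & rank t = n >].
    by exists (rank s); apply/asboolP; exists s.
  case: (ex_minnP exn) => n /asboolP[t St tn] minn.
  have [|z [[/asboolP zlow zmin] zuniq]] := woW [pred t | `[< low S t >]].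
    exists t; apply/asboolP; split=> // u Su.
    by rewrite tn; apply: minn; apply/asboolP; exists u.
  exists z; first by split=> // u ulow; apply: zmin; apply/asboolP.
  move=> u [ulow umin]; apply/esym/zuniq; split; first exact/asboolP.
  by move=> v /asboolP; apply: umin.
have /choice[c cP] S : exists t, S !=set0 -> lowest S t.
  by have [/lowest_ex[t lt _]|] := pselect (S !=set0); [exists t|exists t0].
exists c; split=> [S /cP [[Sc minc] _] //|S S' S'S S'c].
have [|[Sc minc] Wc] := cP S; first by exists (c S); apply: S'S.
have S'0 : S' !=set0 by exists (c S).
have [t _ uniqt] := lowest_ex _ S'0.
rewrite (uniqt (c S) _) ?(uniqt (c S') (cP _ S'0)) //.
split; first by split=> // u /S'S; apply: minc.
move=> u [S'u minu]; apply: Wc; split; first exact: S'S.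
by move=> v Sv; apply: leq_trans (minu _ S'c) (minc _ Sv).
Qed.

Section Layers.
Context {R : realType} {d : Order.disp_t} {B : ctbDistrLatticeType d}.
Variables (A : set B).
Hypothesis bA : boolean_subalgebra A.
Implicit Types (E F K x y z : B).

(** Each [K] is conditioned with the first layer that charges it. The product rule rests on the
    consistency of this choice when [K] shrinks. *)
Lemma layered_fcp (M : set (nat * (B -> R))) :
  (forall m, M m -> fin_additive_probability A m.2) ->
  (forall K, A K -> K != \bot%O -> exists2 m, M m & 0 < m.2 K) ->
  exists P, full_conditional_probability A P /\
    forall K, A K -> K != \bot%O ->
      exists m, [/\ M m, 0 < m.2 K,
        forall l, M l -> 0 < l.2 K -> (m.1 <= l.1)%N &
        forall E, P E K = m.2 (E `&` K)%O / m.2 K].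
Proof.
move=> Mp Mcover.
have [c [cmin cS]] := ranked_choice (0%N, (fun=> 0) : B -> R) fst.
pose S K := [set m | M m /\ 0 < m.2 K].
have SP K : A K -> K != \bot%O -> S K !=set0.
  by move=> AK /(Mcover _ AK)[m Mm mK]; exists m.
pose P E K := (c (S K)).2 (E `&` K)%O / (c (S K)).2 K.
exists P; split; last first.
  move=> K AK K0; have [[Mc cK] minc] := cmin _ (SP _ AK K0).
  by exists (c (S K)); split=> // l Ml lK; apply: minc.
split.
- by move=> E K AE AK K0; rewrite /P -meetA meetxx.
- move=> K AK K0; have [[Mc cK] _] := cmin _ (SP _ AK K0).
  have pc := Mp _ Mc; split.
  + by move=> E AE; rewrite divr_ge0 ?(fap_ge0 pc) //; apply: subalgI.
  + by rewrite /P meet1x divff ?gt_eqF.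
  + move=> E F AE AF EF; rewrite /P meetUl -mulrDl.
    case: pc => _ _ -> //; try exact: subalgI.
    by rewrite meetACA EF meet0x.
- move=> E F K AE AF AK K0 EK0; rewrite /P.
  have [[Mc cK] _] := cmin _ (SP _ AK K0).
  have pc := Mp _ Mc; have AEK := subalgI bA AE AK.
  have -> : (F `&` (E `&` K) = E `&` F `&` K)%O by meet_eq.
  (* Either the layer of [K] charges the smaller event, and is then the first to do so, or it does
     not, and both sides of the product rule vanish. *)
  have [cEK|cEK] := ltP 0 ((c (S K)).2 (E `&` K)%O).
    have -> : c (S (E `&` K)%O) = c (S K).
      apply: cS => // m [Mm mEK]; split=> //; apply: lt_le_trans mEK _.
      by apply: (fap_le bA (Mp _ Mm)) => //; rewrite leIr.
    by rewrite [RHS]mulrC mulrA divfK ?gt_eqF.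
  have cEK0 : (c (S K)).2 (E `&` K)%O = 0.
    by apply/le_anti; rewrite cEK (fap_ge0 pc).
  rewrite cEK0 mul0r mul0r (fap_null bA pc _ AEK _ cEK0) ?mul0r //.
    by do !apply: subalgI.
  by meet_le.
Qed.

End Layers.

(** * Coherence *)

Section Coherence.
Context {R : realType} {d : Order.disp_t} {B : ctbDistrLatticeType d}.
Variables (A : set B).
Hypothesis bA : boolean_subalgebra A.
Implicit Types (E F K x y z : B) (P : B -> B -> R).

Lemma decides_disjoint y x : y != \bot%O -> (y `&` x)%O = \bot%O ->
  (y <= x)%O = false.
Proof. by move=> y0 yx; apply/negP => /meet_idPl; rewrite yx => /esym/eqP;
  apply/negP. Qed.

Let D n (e : 'I_n -> B * B) :=
  generated [set x | exists j, x = (e j).1 \/ x = (e j).2].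

(* The expectation of the gain under [m], computed by splitting on the events
   involved until only atoms remain, is zero. *)
Lemma gain_lower_bound P n (e : 'I_n -> B * B) (s : 'I_n -> R) (m : B -> R)
    (eps : R) :
  let H0 := (\join_(j < n) (e j).2)%O in
  fin_additive_probability A m ->
  (forall j, A (e j).1 /\ A (e j).2) ->
  m H0 = 1 ->
  (forall j, m ((e j).1 `&` (e j).2)%O = P (e j).1 (e j).2 * m (e j).2) ->
  (forall C, atom (D e) C -> (C <= H0)%O -> eps <= gain P e s C) ->
  eps <= 0.
Proof.
move=> H0 pm Ae mH0 mP epsP.
have D1 j : D e (e j).1 by apply: sub_gen_smallest; exists j; left.
have D2 j : D e (e j).2 by apply: sub_gen_smallest; exists j; right.
have bD : boolean_subalgebra (D e) by exact: generated_subalgebra.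
have DA : D e `<=` A.
  by apply: generated_subset => // x [j [->|->]]; case: (Ae j).
(* [h y] is the integral of the gain over [y] under [m]. *)
pose h y := \sum_(j < n) s j *
  (m ((e j).1 `&` (e j).2 `&` y)%O - P (e j).1 (e j).2 * m ((e j).2 `&` y)%O).
have hsplit y x : D e y -> D e x -> h y = h (y `&` x)%O + h (y `&` ~` x)%O.
  move=> Dy Dx; rewrite /h -big_split /=; apply: eq_bigr => j _.
  have [A1 A2] := Ae j; have Ay := DA _ Dy; have Ax := DA _ Dx.
  rewrite (fap_split bA pm (subalgI bA (subalgI bA A1 A2) Ay) Ax).
  rewrite (fap_split bA pm (subalgI bA A2 Ay) Ax) -!meetA.
  by ring.
(* Where all events involved are decided, the gain is constant: [y] is either impossible or an
   atom. *)
have hdec y : D e y -> (y <= H0)%O ->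
    (forall x, (exists j, x = (e j).1 \/ x = (e j).2) -> decides y x) ->
    eps * m y <= h y.
  move=> Dy yH0 decy; have [y0|y0] := eqVneq y \bot%O.
    rewrite y0 (fap0 bA pm) mulr0 /h big1 // => j _.
    by rewrite !meetx0 (fap0 bA pm) mulr0 subrr mulr0.
  have atomy : atom (D e) y by apply: atom_generated.
  suff -> : h y = gain P e s y * m y.
    by rewrite ler_wpM2r ?epsP ?(fap_ge0 pm) //; apply: DA.
  rewrite /h /gain mulr_suml; apply: eq_bigr => j _.
  have [y2|y2] : decides y (e j).2 by apply: decy; exists j; right.
    rewrite -meetA (meet_idPr y2) y2 mulr1.
    have [y1|y1] : decides y (e j).1 by apply: decy; exists j; left.
      by rewrite (meet_idPr y1) y1 -mulrA mulrBl mul1r.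
    rewrite meetC y1 (fap0 bA pm) (decides_disjoint y0 y1).
    by rewrite -mulrA mulrBl mul0r.
  rewrite -meetA [((e j).2 `&` y)%O]meetC y2 meetx0 (fap0 bA pm).
  by rewrite (decides_disjoint y0 y2) !mulr0 subrr mulr0 mul0r.
(* Induction on the events still to be split on; both parts of [y] decide [z]. *)
have hle (l : seq B) : (forall x, x \in l -> D e x) -> forall y, D e y ->
    (y <= H0)%O ->
    (forall x, (exists j, x = (e j).1 \/ x = (e j).2) ->
      x \in l \/ decides y x) ->
    eps * m y <= h y.
  elim: l => [_ y Dy yH0 decy|z l IH Dl y Dy yH0 decy].
    by apply: hdec => // x /decy[].
  have Dz : D e z by apply: Dl; rewrite mem_head.
  have {}Dl x : x \in l -> D e x by move=> xl; apply: Dl;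
    rewrite in_cons xl orbT.
  rewrite (hsplit y z) // (fap_split bA pm (DA _ Dy) (DA _ Dz)) mulrDr.
  apply: lerD; apply: IH => //.
  - exact: (subalgI bD).
  - by rewrite (le_trans (leIl _ _)).
  - move=> x /decy[|dx]; last by right; apply: decides_le dx; apply: leIl.
    rewrite in_cons => /orP[/eqP->|]; last by left.
    by right; apply: decides_meet.
  - by apply: (subalgI bD) => //; apply: (subalgC bD).
  - by rewrite (le_trans (leIl _ _)).
  - move=> x /decy[|dx]; last by right; apply: decides_le dx; apply: leIl.
    rewrite in_cons => /orP[/eqP->|]; last by left.
    by right; apply: decides_meetC.
have DH0 : D e H0 by apply: big_ind => //;
  [apply: (subalg0 bD)|apply: (subalgU bD)].
have := hle ([seq (e j).1 | j <- enum 'I_n] ++ [seq (e j).2 | j <- enum 'I_n]).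
move=> /(_ _ H0 DH0 (lexx _)); rewrite mH0 mulr1.
(* Over [H0] each single bet is fair, by [mP]. *)
have -> : h H0 = 0.
  rewrite /h big1 // => j _.
  have jH0 : ((e j).2 <= H0)%O by apply: joins_sup.
  by rewrite -meetA (meet_idPl jH0) mP subrr mulr0.
apply.
  by move=> x; rewrite mem_cat => /orP[] /mapP[j _ ->].
move=> x [j xj]; left; rewrite mem_cat.
by apply/orP; case: xj => ->; [left|right]; apply/mapP; exists j;
  rewrite ?mem_enum.
Qed.

Lemma coherent_gains P n (e : 'I_n -> B * B) (s : 'I_n -> R) (m : B -> R) :
  let H0 := (\join_(j < n) (e j).2)%O in
  fin_additive_probability A m ->
  (forall j, A (e j).1 /\ A (e j).2) ->
  m H0 = 1 ->
  (forall j, m ((e j).1 `&` (e j).2)%O = P (e j).1 (e j).2 * m (e j).2) ->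
  let gains := [set gain P e s C | C in [set C | atom (D e) C /\ (C <= H0)%O]]
    in
  inf gains <= 0 <= sup gains.
Proof.
move=> H0 pm Ae mH0 mP; cbv zeta; set gains := [set _ | _ in _].
apply/andP; split.
  (* Without an infimum, [inf] is [0] by convention. *)
  have [[_ lbg]|/inf_out->//] := pselect (has_inf gains).
  apply: (gain_lower_bound pm Ae mH0 mP (s := s)) => C aC CH0.
  by apply: ge_inf => //; exists C.
have [[_ ubg]|/sup_out->//] := pselect (has_sup gains).
(* The upper half is the lower half for the opposite stakes. *)
rewrite -oppr_le0.
apply: (gain_lower_bound pm Ae mH0 mP (s := fun j => - s j)) => C aC CH0.
have -> : gain P e (fun j => - s j) C = - gain P e s C.
  by rewrite /gain -sumrN; apply: eq_bigr => j _; rewrite !mulNr.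
by rewrite lerN2; apply: ub_le_sup => //; exists C.
Qed.

End Coherence.

(** * Extensions of a strategy and a prior *)

Section Assessment.
Context {R : realType} {d : Order.disp_t} {B : ctbDistrLatticeType d}.
Variables (I : Type) (H : I -> B) (AL A : set B).
Variables (sigma : B -> B -> R) (pi : B -> R).
Hypotheses (partH : partition_events H).
Hypotheses (bAL : boolean_subalgebra AL) (bA : boolean_subalgebra A).
Hypotheses (ALA : AL `<=` A) (ALH : forall i, AL (H i)).
Hypothesis decH : forall x i, AL x -> decides (H i) x.
Hypothesis atomic : forall x, A x -> x != \bot%O ->
  exists w, [/\ w != \bot%O, (w <= x)%O & forall y, A y -> decides w y].
Hypotheses (strat : strategy A H sigma) (ppi : fin_additive_probability AL pi).
Implicit Types (E F K x y z : B) (p q : B -> R).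

Let AH i : A (H i). Proof. exact: ALA. Qed.

Lemma partition_neq0 i : H i != \bot%O. Proof. by case: partH. Qed.

Lemma strategy_fap i : fin_additive_probability A (fun F => sigma F (H i)).
Proof. by case: (strat i). Qed.

Lemma strategy_le F i : A F -> (H i <= F)%O -> sigma F (H i) = 1.
Proof. by move=> AF /meet_idPr HF; have [+ _] := strat i; apply. Qed.

Lemma strategy_meet F i : A F -> sigma (F `&` H i)%O (H i) = sigma F (H i).
Proof.
by move=> AF; apply: (fap_certain bA (strategy_fap i)) => //;
  apply: strategy_le.
Qed.

Lemma strategy_disjoint F i : A F -> (F `&` H i)%O = \bot%O ->
  sigma F (H i) = 0.
Proof. by move=> AF FH; rewrite -strategy_meet // FH (fap0 bA (strategy_fap
  i)). Qed.

Lemma strategy_other i j : i <> j -> sigma (H j) (H i) = 0.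
Proof. by case: partH => _ disH _ ij; apply: strategy_disjoint => //;
  apply: disH => /esym. Qed.

(** * Joint probabilities described by disintegration *)

Let Pj := joint_probabilities A AL H pi sigma.

(** The disintegration is imposed on each [H i] separately and not as a sum over [I]: a finitely
    additive [pi] may have mass that the [H i] do not exhaust. *)
Definition disintegrable p : Prop :=
  [/\ fin_additive_probability A p, forall E, AL E -> p E = pi E &
      forall F i, A F -> p (F `&` H i)%O = sigma F (H i) * pi (H i)].

(** A bet on [F] given [H i] with stake [1], one on their conjunction with stake [-1] and one on
    [H i] with stake [sigma F (H i)] have together the same gain [c] on every atom, so coherence
    forces [c = 0]. *)
Lemma joint_disintegrable p : Pj p -> disintegrable p.
Proof.
move=> [pp ppiE [P [Pp Psig [_ coh]]]]; split=> // F i AF.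
have AFH := subalgI bA AF (AH i).
pose l := [:: (F, H i); ((F `&` H i)%O, \top%O); (H i, \top%O)].
pose e (j : 'I_3) := nth (\top%O, \top%O) l j.
pose s (j : 'I_3) := nth 0 [:: 1; -1; sigma F (H i)] j.
pose c := p (F `&` H i)%O - sigma F (H i) * p (H i).
have gE C : gain P e s C = c.
  rewrite /gain !big_ord_recl big_ord0 /= /e /s /= !lex1 lexI !Pp // Psig //.
  by case: (C <= F)%O; case: (C <= H i)%O => /=; rewrite /c; ring.
have Ae j : (A `*` ([set \top%O] `|` range H)) (e j).
  case: j => -[|[|[|//]]] j3; split=> //=; try by left.
  by right; exists i.
suff c0 : c = 0 by apply/eqP; rewrite -(ppiE _ (ALH i)) -subr_eq0; apply/eqP.
have := coh _ e s Ae; cbv zeta.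
set D := generated _.
(* An atom has to be exhibited: for an empty set of gains [inf] and [sup] are both [0] and coherence
   says nothing. *)
have [C [DC C0 _ Cl]] : exists C, [/\ D C, C != \bot%O, (C <= \top)%O &
    forall x, x \in [:: F; H i; (F `&` H i)%O; \top%O] -> decides C x].
  have bD : boolean_subalgebra D by exact: generated_subalgebra.
  have DF : D F.
    by apply: sub_gen_smallest; exists (@Ordinal 3 0 isT); left.
  have DH : D (H i).
    by apply: sub_gen_smallest; exists (@Ordinal 3 0 isT); right.
  apply: constituent_ex => //; last 2 first.
  - exact: (subalg1 bD).
  - by apply: contra (partition_neq0 i) => /eqP t0; rewrite -lex0 -t0 lex1.
  move=> x; rewrite !inE => /or4P[] /eqP-> //.
    exact: (subalgI bD).
  exact: (subalg1 bD).
have aC : atom D C.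
  apply: atom_generated => // x [[[|[|[|//]]] j3] /=]; rewrite /e /= => -[]->;
    by apply: Cl; rewrite !inE eqxx ?orbT.
have CH0 : (C <= \join_(j < 3) (e j).2)%O.
  apply: (le_trans (lex1 C)).
  exact: (joins_sup (j := @Ordinal 3 1 isT) (fun j => (e j).2)).
set gains := [set _ | _ in _].
have -> : gains = [set c].
  by apply/seteqP; split=> [_ [C' _ <-]|_ ->]; [apply: gE|exists C].
by rewrite inf1 sup1 -eq_le eq_sym => /eqP.
Qed.

(** Coherence follows from one probability that is certain of the union of the conditioning events
    and makes every bet fair: [p] if [\top] is among these events, otherwise the charge of the
    strategy at any one of them. *)
Lemma disintegrable_joint p : disintegrable p -> Pj p.
Proof.
move=> [pp ppiE pdis].
pose P E K := if K == \top%O then p E else sigma E K.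
have P1 F : P F \top%O = p F by rewrite /P eqxx.
(* If [H i] is the sure event, disintegration makes [p] and the charge at [H i] coincide on [A]. *)
have PH F i : A F -> P F (H i) = sigma F (H i).
  move=> AF; rewrite /P; case: eqP => // H1.
  rewrite -[F in p F]meetx1 -H1 pdis // H1.
  by case: ppi => _ -> _; rewrite mulr1 -H1.
split=> //; exists P; split=> //; split.
  move=> [F K] [/= AF [->|[i _ <-]]].
    by rewrite P1 (fap_ge0 pp) // (fap_le1 bA pp).
  by have si := strategy_fap i; rewrite PH // (fap_ge0 si) // (fap_le1 bA si).
(* With no bets the join is [\bot], no atom lies below it, and both extrema of the empty set are
   [0]. *)
move=> [|n] e s Ge.
  cbv zeta; set gains := [set _ | _ in _].
  suff -> : gains = set0 by rewrite inf0 sup0 lexx.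
  apply/seteqP; split=> // g [C [[_ C0 _] +] _].
  by rewrite big_ord0 lex0 (negPf C0).
have Ae j : A (e j).1 /\ A (e j).2.
  have [A1 [->|[i _ <-]]] := Ge j; split=> //; exact: (subalg1 bA).
have [[j0 ej0]|ne] := pselect (exists j, (e j).2 = \top%O).
  apply: (coherent_gains bA s pp Ae).
    suff -> : (\join_(j < n.+1) (e j).2)%O = \top%O :> B by case: pp.
    by apply/le_anti; rewrite lex1 -ej0 joins_sup.
  move=> j; have [A1 [->|[i _ <-]]] := Ge j.
    by rewrite meetx1 P1; case: pp => _ -> _; rewrite mulr1.
  by rewrite pdis // PH // ppiE.
have eH j : exists i, (e j).2 = H i.
  have [A1 [ej|[i _ <-]]] := Ge j; last by exists i.
  by case: ne; exists j.
have [i0 ei0] := eH ord0.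
have si := strategy_fap i0.
apply: (coherent_gains bA s si Ae).
  have AH0 : A (\join_(j < n.+1) (e j).2)%O.
    apply: big_ind => [||j _]; [exact: (subalg0 bA)|exact: (subalgU bA)|].
    by case: (Ae j).
  by apply: strategy_le => //; rewrite -ei0; apply: joins_sup.
move=> j; have [A1 _] := Ae j; have [i ->] := eH j.
(* For [i] other than [i0], the charge at [i0] gives [H i] mass [0] and both sides vanish. *)
rewrite PH //; have [->|/strategy_other ii] := pselect (i0 = i).
  by rewrite strategy_meet // [sigma (H i) _]strategy_le // mulr1.
rewrite ii mulr0; apply: (fap_null bA si _ _ (leIr _ _) (ii)) => //.
exact: subalgI.
Qed.

(** * Averages over finite partitions and their limits *)

Fixpoint cell_sum (mu : B -> B -> R) (s : seq B) y E : R :=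
  if s is x :: s' then
    cell_sum mu s' (y `&` x)%O E + cell_sum mu s' (y `&` ~` x)%O E
  else mu y E.

Lemma cell_sumD (mu : B -> B -> R) s y E F G :
  (forall z, AL z -> mu z G = mu z E + mu z F) ->
  (forall x, x \in s -> AL x) -> AL y ->
  cell_sum mu s y G = cell_sum mu s y E + cell_sum mu s y F.
Proof.
move=> muD; elim: s y => [y _ /muD//|x s IH] y /= sAL ALy.
have ALx : AL x by apply: sAL; rewrite mem_head.
have {}sAL z : z \in s -> AL z by move=> zs; apply: sAL;
  rewrite in_cons zs orbT.
have ALyx := subalgI bAL ALy ALx.
have ALyx' := subalgI bAL ALy (subalgC bAL ALx).
by rewrite (IH _ sAL ALyx) (IH _ sAL ALyx') addrACA.
Qed.

(** A cellwise comparison of [mu] with an additive [nu] adds up to one at [y]; [rel] is later an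
    equality or an inequality. [Z] collects the events that each cell has to decide. *)
Lemma cell_sum_rel (mu : B -> B -> R) (rel : R -> R -> Prop) (nu : B -> R)
    (Z : set B) s y E :
  (forall a b a' b', rel a b -> rel a' b' -> rel (a + a') (b + b')) ->
  (forall u x, AL u -> AL x -> nu u = nu (u `&` x)%O + nu (u `&` ~` x)%O) ->
  (forall u, AL u -> (forall z, Z z -> decides u z) -> rel (mu u E) (nu u)) ->
  (forall x, x \in s -> AL x) -> AL y ->
  (forall z, Z z -> z \in s \/ decides y z) ->
  rel (cell_sum mu s y E) (nu y).
Proof.
move=> relD nuD muE; elim: s y => [|x s IH] y /= sAL ALy Zy.
  by apply: muE => // z /Zy[].
have ALx : AL x by apply: sAL; rewrite mem_head.
have {}sAL u : u \in s -> AL u by move=> us; apply: sAL;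
  rewrite in_cons us orbT.
rewrite (nuD y x) //; apply: relD; apply: IH => //.
- exact: (subalgI bAL).
- move=> z /Zy[|zy]; last by right; apply: decides_le zy; apply: leIl.
  rewrite in_cons => /orP[/eqP->|]; last by left.
  by right; apply: decides_meet.
- by apply: (subalgI bAL) => //; apply: (subalgC bAL).
- move=> z /Zy[|zy]; last by right; apply: decides_le zy; apply: leIl.
  rewrite in_cons => /orP[/eqP->|]; last by left.
  by right; apply: decides_meetC.
Qed.

Lemma partition_inhabited : exists i : I, True.
Proof.
have top0 : \top%O != \bot%O :> B.
  apply/eqP => top0; have [_ + _] := ppi.
  by rewrite top0 (fap0 bAL ppi) => /eqP; rewrite eq_sym oner_eq0.
by have [i _] := partition_cover partH top0; exists i.
Qed.

(** [H i] is an atom of [AL], so [y] is [H i] or [\bot]. *)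
Lemma disintegrable_meet p y F i : disintegrable p -> AL y -> A F ->
  (y <= H i)%O -> p (F `&` y)%O = sigma F (H i) * pi y.
Proof.
move=> [pp ppiE pdis] ALy AF yH.
have [Hy|Hy] := decH i ALy.
  have -> : y = H i by apply/le_anti; rewrite yH Hy.
  exact: pdis.
have -> : y = \bot%O by rewrite -Hy (meet_idPr yH).
by rewrite meetx0 (fap0 bA pp) (fap0 bAL ppi) mulr0.
Qed.

(** Below some [H i] the strategy dictates the charge; elsewhere a well-placed point mass beats
    every competitor. The third clause keeps the factor [pi y] because [\bot] lies below all the
    [H i] at once. *)
Lemma local_charge X Y y : A X -> A Y -> (X `&` Y)%O = \bot%O -> AL y ->
  exists m, [/\ fin_additive_probability A m,
    y != \bot%O -> m y = 1,
    forall i, (y <= H i)%O -> forall F, A F ->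
      pi y * m F = sigma F (H i) * pi y &
    forall p, disintegrable p ->
      pi y * m X <= p (X `&` y)%O /\ p (Y `&` y)%O <= pi y * m Y].
Proof.
move=> AX AY XY ALy; have Ay := ALA ALy.
have [[i yH]|ynH] := pselect (exists i, (y <= H i)%O).
  exists (fun F => sigma F (H i)); split.
  - exact: strategy_fap.
  - move=> y0; apply: strategy_le => //.
    by have [//|Hy] := decH i ALy; rewrite -(meet_idPr yH) Hy eqxx in y0.
  - move=> j yHj F AF; have [->|ij] := pselect (i = j); first by rewrite mulrC.
    have -> : y = \bot%O.
      apply/eqP; rewrite -lex0; have [_ disH _] := partH.
      by rewrite -(disH _ _ ij) lexI yH.
    by rewrite (fap0 bAL ppi) mul0r mulr0.
  - by move=> p pd; rewrite !(disintegrable_meet pd ALy _ yH) // mulrC [pi y *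
      _]mulrC.
have y0 : y != \bot%O.
  have [i _] := partition_inhabited.
  by apply/eqP => y0; apply: ynH; exists i; rewrite y0 le0x.
(* A point of [Y] is outside [X] by disjointness, so one point serves both aims; it falls in [X]
   only when all of [y] does. *)
have [w [w0 wy decw wX wY]] : exists w, [/\ w != \bot%O, (w <= y)%O,
    forall x, A x -> decides w x, (w <= X)%O -> (y <= X)%O &
    (w <= Y)%O \/ (Y `&` y)%O = \bot%O].
  have [yY0|yY0] := eqVneq (Y `&` y)%O \bot%O; last first.
    have [w [w0 + decw]] := atomic (subalgI bA AY Ay) yY0.
    rewrite lexI => /andP[wY wy]; exists w; split=> //; last by left.
    move=> wX; case/eqP: w0; apply/eqP; rewrite -lex0 -XY.
    by rewrite lexI wX.
  have [yX0|yX0] := eqVneq (y `&` ~` X)%O \bot%O.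
    have [w [w0 wy decw]] := atomic Ay y0; exists w; split=> //; last by right.
    by move=> _; move/meet0P: yX0; rewrite complK.
  have [w [w0 + decw]] := atomic (subalgI bA Ay (subalgC bA AX)) yX0.
  rewrite lexI => /andP[wy wX]; exists w; split=> //; last by right.
  move=> wX'; case/eqP: w0; apply/eqP; rewrite -lex0 -(meetxC X).
  by rewrite lexI wX'.
exists (fun x => (w <= x)%O%:R); split.
- exact: dirac_fap.
- by rewrite wy.
- by move=> i yH; case: ynH; exists i.
- move=> p [pp ppiE pdis]; have piy := ppiE _ ALy; split.
    have [/wX yX|_] := boolP (w <= X)%O.
      by rewrite (meet_idPr yX) mulr1 piy.
    by rewrite mulr0 (fap_ge0 pp) //; apply: subalgI.
  case: wY => [->|->]; last first.
    by rewrite (fap0 bA pp) mulr_ge0 ?ler0n // (fap_ge0 ppi).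
  by rewrite mulr1 -piy (fap_le bA pp) ?leIr //; apply: subalgI.
Qed.

(** The values prescribed by [pi] and [sigma] hold once the list of cutting events contains the
    event concerned, and the comparisons with [p'] hold for every list; both survive the limit over
    growing lists. *)
Lemma extremal_disintegrable X Y : A X -> A Y -> (X `&` Y)%O = \bot%O ->
  exists2 p, disintegrable p &
    forall p', disintegrable p' -> p X <= p' X /\ p' Y <= p Y.
Proof.
move=> AX AY XY.
have /choice[m mP] y : exists m, AL y ->
    [/\ fin_additive_probability A m,
      y != \bot%O -> m y = 1,
      forall i, (y <= H i)%O -> forall F, A F ->
        pi y * m F = sigma F (H i) * pi y &
      forall p, disintegrable p ->
        pi y * m X <= p (X `&` y)%O /\ p (Y `&` y)%O <= pi y * m Y].
  have [ALy|] := pselect (AL y); last by exists (fun=> 0).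
  by have [m ?] := local_charge AX AY XY ALy; exists m.
pose mu y E := pi y * m y E.
have mu_out y E : AL y -> A E -> (y `&` E)%O = \bot%O -> mu y E = 0.
  move=> ALy AE yE; rewrite /mu; have [->|y0] := eqVneq y \bot%O.
    by rewrite (fap0 bAL ppi) mul0r.
  have [mp /(_ y0) my _ _] := mP y ALy.
  by rewrite -(fap_certain bA mp AE (ALA ALy) my) meetC yE (fap0 bA mp) mulr0.
have mu_in y E : AL y -> A E -> (y <= E)%O -> mu y E = pi y.
  move=> ALy AE yE; rewrite /mu; have [->|y0] := eqVneq y \bot%O.
    by rewrite (fap0 bAL ppi) mul0r.
  have [mp /(_ y0) my _ _] := mP y ALy; suff -> : m y E = 1 by rewrite mulr1.
  apply/le_anti; rewrite (fap_le1 bA mp AE) /= -my.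
  by apply: (fap_le bA mp) => //; apply: ALA.
pose cells := [set s : seq B | forall x, x \in s -> AL x].
(* A property holds eventually if it holds for all lists in [AL] that contain some fixed list
   [t]. *)
pose finer := filter_from cells (fun t => [set s | cells s /\ {subset t <= s}]).
have finerP : ProperFilter finer.
  apply: filter_from_proper; last by move=> t ct; exists t; split.
  apply: filter_from_filter; first by exists [::].
  move=> t u ct cu; exists (t ++ u).
    by move=> x; rewrite mem_cat => /orP[/ct|/cu].
  move=> s [cs tus]; split; split=> // x xt; apply: tus; rewrite mem_cat xt //.
  by rewrite orbT.
have ALt := subalg1 bAL; have At := subalg1 bA.
have near_cells Z (S : set (seq B)) : cells Z ->
    (forall s, cells s -> {subset Z <= s} -> S s) -> \forall s \near finer, S s.
  by move=> cZ ZS; exists Z => // s [cs Zs]; apply: ZS.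
(* [Z] names at most one event that the cells have to decide. *)
have cell_eq nu Z s E : (forall u x, AL u -> AL x ->
      nu u = nu (u `&` x)%O + nu (u `&` ~` x)%O) ->
    (forall u, AL u -> (forall z, Z = Some z -> decides u z) ->
      mu u E = nu u) ->
    cells s -> (forall z, Z = Some z -> z \in s) ->
    cell_sum mu s \top%O E = nu \top%O.
  move=> nuD muE cs Zs; apply: (cell_sum_rel (rel := eq) (Z :=
    [set z | Z = Some z])) => //.
    by move=> a b a1 b1 -> ->.
  by move=> z /Zs; left.
have mu_fap y : AL y -> fin_additive_probability A (m y) by move=> /mP[].
have [|q [qp qP]] := @ultralimit_fap R d B A bA _ finer (fun s =>
  cell_sum mu s \top%O).
  apply: (near_cells [::]) => // s cs _; split.
  - move=> E AE; apply: (cell_sum_rel (rel := fun a b => b <= a)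
      (nu := fun=> 0) (Z := set0)) => //.
    + by move=> a b a' b'; apply: lerD.
    + by move=> *; rewrite addr0.
    + move=> u ALu _; rewrite mulr_ge0 ?(fap_ge0 ppi) //.
      exact: (fap_ge0 (mu_fap _ ALu)).
  - have [_ <- _] := ppi; apply: (cell_eq pi None) => //.
      by move=> u x ALu ALx; apply: (fap_split bAL).
    by move=> u ALu _; apply: mu_in => //; apply: lex1.
  - move=> E F AE AF EF; apply: cell_sumD => // z ALz.
    by have [_ _ mD] := mu_fap _ ALz; rewrite /mu mD // mulrDr.
have qE x c : A x -> (\forall s \near finer, cell_sum mu s \top%O x = c) ->
  q x = c.
  move=> Ax xc; have [qle qge] := qP x c Ax; apply/le_anti/andP; split.
    by apply: qle; apply: filterS xc => s ->.
  by apply: qge; apply: filterS xc => s ->.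
exists q.
  split=> // [E ALE|F i AF].
  - apply: qE; first exact: ALA.
    apply: (near_cells [:: E]); first by move=> x; rewrite inE => /eqP->.
    (* Once [E] is listed, each cell is inside or outside [E], and [mu] is there the [pi]-mass of
       the part in [E]. *)
    move=> s cs Es; rewrite -[E in RHS]meet1x.
    apply: (cell_eq (fun y => pi (y `&` E)%O) (Some E)) => //.
    + move=> u x ALu ALx; rewrite (fap_split bAL ppi (subalgI bAL ALu ALE) ALx).
      by rewrite meetAC [(u `&` E `&` ~` x)%O]meetAC.
    + move=> u ALu /(_ _ erefl)[uE|uE].
        by rewrite mu_in ?(meet_idPl uE) //; apply: ALA.
      by rewrite mu_out ?uE ?(fap0 bAL ppi) //; apply: ALA.
    + by move=> z [<-]; apply: Es; rewrite mem_head.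
  - have AFH := subalgI bA AF (AH i); apply: qE => //.
    apply: (near_cells [:: H i]); first by move=> x; rewrite inE => /eqP->.
    move=> s cs Es; rewrite -[X in pi X]meet1x.
    apply: (cell_eq (fun y => sigma F (H i) * pi (y `&` H i)%O) (Some (H i)))
      => //.
    + move=> u x ALu ALx.
      rewrite (fap_split bAL ppi (subalgI bAL ALu (ALH i)) ALx) mulrDr.
      by rewrite meetAC [(u `&` H i `&` ~` x)%O]meetAC.
    + move=> u ALu /(_ _ erefl)[uH|uH].
        have [_ _ mH _] := mP u ALu.
        by rewrite (meet_idPl uH) /mu (mH i) // strategy_meet.
      rewrite uH (fap0 bAL ppi) mulr0 mu_out //.
      by rewrite meetCA uH meetx0.
    + by move=> z [<-]; apply: Es; rewrite mem_head.
move=> p' pd; have [pp _ _] := pd.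
have pD Z u x : A Z -> AL u -> AL x ->
    p' (Z `&` u)%O = p' (Z `&` (u `&` x))%O + p' (Z `&` (u `&` ~` x))%O.
  move=> AZ ALu ALx; rewrite !meetA; apply: (fap_split bA pp); last exact: ALA.
  by apply: (subalgI bA) => //; apply: ALA.
split.
  apply: (qP X (p' X) AX).1; apply: (near_cells [::]) => // s cs _.
  rewrite -{2}[X]meetx1.
  apply: (cell_sum_rel (rel := fun a b => a <= b)
    (nu := fun y => p' (X `&` y)%O) (Z := set0)) => //.
  - by move=> a b a' b'; apply: lerD.
  - by move=> u x; apply: pD.
  - by move=> u ALu _; have [_ _ _ /(_ _ pd)[]] := mP u ALu.
apply: (qP Y (p' Y) AY).2; apply: (near_cells [::]) => // s cs _.
rewrite -{1}[Y]meetx1.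
apply: (cell_sum_rel (rel := fun a b => b <= a)
  (nu := fun y => p' (Y `&` y)%O) (Z := set0)) => //.
- by move=> a b a' b'; apply: lerD.
- by move=> u x; apply: pD.
- by move=> u ALu _; have [_ _ _ /(_ _ pd)[]] := mP u ALu.
Qed.

(** * Full conditional extensions and their joint probabilities *)

Let PP := fcp_extensions A AL H pi sigma.

(** Disintegration is the product rule given [\top] with [H i] as intermediate event. *)
Lemma fcp_disintegrable P : PP P -> disintegrable (fun E => P E \top%O).
Proof.
move=> [[_ P2 P3] Ppi Psig]; have At := subalg1 bA.
have top0 : \top%O != \bot%O :> B.
  have [i _] := partition_inhabited.
  by apply: contra (partition_neq0 i) => /eqP t0; rewrite -lex0 -t0 lex1.
split=> //; first exact: P2.
move=> F i AF; rewrite -(Ppi _ (ALH i)) meetC P3 ?meetx1 ?partition_neq0 //.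
by rewrite Psig // mulrC.
Qed.

Lemma fcp_bayes P F K : PP P -> A F -> A K -> 0 < P K \top%O ->
  P F K = P (F `&` K)%O \top%O / P K \top%O.
Proof.
move=> PPP AF AK K0; have [[_ _ P3] _ _] := PPP.
have [pp _ _] := fcp_disintegrable PPP; have At := subalg1 bA.
have Kn0 : K != \bot%O by apply/eqP => Kb; rewrite Kb (fap0 bA pp) ltxx in K0.
have top0 : \top%O != \bot%O :> B.
  by apply: contra Kn0 => /eqP t0; rewrite -lex0 -t0 lex1.
have := P3 K F _ AK AF At top0; rewrite !meetx1 => /(_ Kn0).
by rewrite meetC => ->; rewrite mulrC mulKf ?gt_eqF.
Qed.

(* The layers of [P] are [p], [q1], [q2], the charges of the strategy and
   the Dirac masses at the atoms; conditioning on [K] uses the first layer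
   that charges [K]. *)
Lemma fcp_extension p q1 q2 : disintegrable p ->
  fin_additive_probability A q1 -> fin_additive_probability A q2 ->
  (forall F i, A F -> q1 (F `&` H i)%O = sigma F (H i) * q1 (H i)) ->
  (forall i, 0 < q2 (H i) -> 0 < p (H i) \/ 0 < q1 (H i)) ->
  exists2 P, PP P &
    (forall F, A F -> P F \top%O = p F) /\
    forall F K, A F -> A K -> K != \bot%O -> p K = 0 ->
      (0 < q1 K -> P F K = q1 (F `&` K)%O / q1 K) /\
      (q1 K = 0 -> 0 < q2 K -> P F K = q2 (F `&` K)%O / q2 K).
Proof.
move=> [pp ppiE pdis] qp1 qp2 qdis1 qnull2.
pose layer := [set m : nat * (B -> R) |
  [\/ m = (0%N, p), m = (1%N, q1), m = (2%N, q2) |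
    (exists i, m = (3%N, sigma^~ (H i))) \/
    (exists w, [/\ w != \bot%O, forall y, A y -> decides w y &
      m = (4%N, fun x => (w <= x)%O%:R)])]].
have layer0 : layer (0%N, p) by constructor 1.
have layer1 : layer (1%N, q1) by constructor 2.
have layer2 : layer (2%N, q2) by constructor 3.
have layer3 i : layer (3%N, sigma^~ (H i)) by constructor 4; left; exists i.
have [||P [fcpP Player]] := layered_fcp bA (M := layer).
- move=> m [->|->|->|[[i ->]|[w [w0 decw ->]]]] //=; first exact: strategy_fap.
  exact: dirac_fap.
- move=> K AK K0; have [w [w0 wK decw]] := atomic AK K0.
  exists (4%N, fun x => (w <= x)%O%:R); last by rewrite /= wK ltr01.
  by constructor 4; right; exists w.
have At := subalg1 bA.
have top0 : \top%O != \bot%O :> B.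
  have [i _] := partition_inhabited.
  by apply: contra (partition_neq0 i) => /eqP t0; rewrite -lex0 -t0 lex1.
have Pp F : A F -> P F \top%O = p F.
  move=> AF; have p1 : p \top%O = 1 by case: pp.
  have [m [Lm _ minm ->]] := Player _ At top0.
  have : (m.1 <= 0)%N by apply: (minm _ layer0); rewrite /= p1 ltr01.
  move: Lm => [->|->|->|[[i ->]|[w [_ _ ->]]]] //= _.
  by rewrite meetx1 p1 divr1.
exists P; last first.
  split=> // F K AF AK K0 pK.
  have [m [Lm mK minm ->]] := Player _ AK K0; split=> [qK|q1K qK].
    have : (m.1 <= 1)%N by apply: (minm _ layer1).
    move: Lm mK {minm} => [->|->|->|[[i ->]|[w [_ _ ->]]]] //=.
    by rewrite pK ltxx.
  have : (m.1 <= 2)%N by apply: (minm _ layer2).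
  move: Lm mK {minm} => [->|->|->|[[i ->]|[w [_ _ ->]]]] //=.
    by rewrite pK ltxx.
  by rewrite q1K ltxx.
split=> // [E ALE|F i AF]; first by rewrite Pp ?ppiE //; apply: ALA.
have [m [Lm mK minm ->]] := Player _ (AH i) (partition_neq0 i).
have sii : sigma (H i) (H i) = 1 by apply: strategy_le.
(* The charge of the strategy at [H i] comes before any Dirac mass. By hypothesis [q2] is never
   first on [H i], and every remaining layer returns [sigma]: among the charges of the strategy,
   only the one at [H i] charges [H i]. *)
have : (m.1 <= 3)%N by apply: (minm _ (layer3 i)); rewrite /= sii ltr01.
move: Lm mK minm => [->|->|->|[[j ->]|[w [_ _ ->]]]] //= mK minm _.
- by rewrite pdis // ppiE // mulfK // -ppiE // gt_eqF.
- by rewrite qdis1 // mulfK // gt_eqF.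
- have [pH|qH] := qnull2 _ mK; first by have := minm _ layer0 pH.
  by have := minm _ layer1 qH.
- have [ji|/strategy_other ji] := pselect (j = i);
    last by rewrite ji ltxx in mK.
  by rewrite ji sii divr1 strategy_meet.
Qed.

Lemma fcp_extension1 p : disintegrable p ->
  exists2 P, PP P & forall F, A F -> P F \top%O = p F.
Proof.
move=> pd; have [pp ppiE pdis] := pd.
have [|//|||P PPP [Pp _]] := fcp_extension (q1 := p) (q2 := p) pd; try by [].
- by move=> F i AF; rewrite pdis // ppiE.
- by move=> i; left.
- by exists P.
Qed.

(** * Attained envelopes of the joint probabilities *)

Lemma extremal_joint X Y : A X -> A Y -> (X `&` Y)%O = \bot%O ->
  exists p, [/\ Pj p, p X = lower Pj X, p Y = upper Pj Y,
    lbound (values Pj X) (lower Pj X) & ubound (values Pj Y) (upper Pj Y)].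
Proof.
move=> AX AY XY; have [p pd pmin] := extremal_disintegrable AX AY XY.
have Pjp := disintegrable_joint pd.
have lbX : lbound (values Pj X) (p X).
  by move=> _ [p' /joint_disintegrable/pmin[+ _] <-].
have ubY : ubound (values Pj Y) (p Y).
  by move=> _ [p' /joint_disintegrable/pmin[_ +] <-].
have lowX : lower Pj X = p X by apply: inf_attained => //; exists p.
have uppY : upper Pj Y = p Y by apply: sup_attained => //; exists p.
by exists p; split; rewrite ?lowX ?uppY.
Qed.

Lemma lower_joint_le p X : A X -> Pj p -> lower Pj X <= p X.
Proof.
move=> AX Pjp; have [|_ [_ _ _ lbX _]] := @extremal_joint X \bot%O AX (subalg0
  bA).
  by rewrite meetx0.
by apply: lbX; exists p.
Qed.

Lemma upper_joint_ge p X : A X -> Pj p -> p X <= upper Pj X.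
Proof.
move=> AX Pjp; have [|_ [_ _ _ _ ubX]] := @extremal_joint \bot%O X (subalg0
  bA) AX.
  by rewrite meet0x.
by apply: ubX; exists p.
Qed.

(** * Conditioning events of positive lower probability *)

Lemma compl_meet_disjoint F K : ((F `&` K) `&` (~` F `&` K))%O = \bot%O.
Proof. by rewrite meetACA meetxC meet0x. Qed.

(** The constraint costs nothing: one probability attains the upper value on the part of [K] outside
    [F] together with the unconstrained lower value on the part inside. *)
Lemma L_joint_attained F K : A F -> A K ->
  L_values Pj F K (lower Pj (F `&` K)%O) /\
  lbound (L_values Pj F K) (lower Pj (F `&` K)%O).
Proof.
move=> AF AK; have AFK := subalgI bA AF AK.
have AFCK := subalgI bA (subalgC bA AF) AK.
have [p [Pjp pX pY _ _]] := extremal_joint AFK AFCK (compl_meet_disjoint F K).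
split; first by exists p.
by move=> _ [p' [Pjp' _] <-]; apply: lower_joint_le.
Qed.

Lemma U_joint_attained F K : A F -> A K ->
  U_values Pj F K (upper Pj (F `&` K)%O) /\
  ubound (U_values Pj F K) (upper Pj (F `&` K)%O).
Proof.
move=> AF AK; have AFK := subalgI bA AF AK.
have AFCK := subalgI bA (subalgC bA AF) AK.
have [|p [Pjp pX pY _ _]] := extremal_joint AFCK AFK.
  by rewrite meetC compl_meet_disjoint.
split; first by exists p.
by move=> _ [p' [Pjp' _] <-]; apply: upper_joint_ge.
Qed.

(** With [x] and [y] the masses of [K] inside and outside [F], the conditional value [x / (x + y)]
    increases in [x] and decreases in [y]; a single [p] is extremal for both. *)
Lemma cond_values_positive F K : A F -> A K -> 0 < lower Pj K ->
  let r := lower Pj (F `&` K)%O /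
    (lower Pj (F `&` K)%O + upper Pj (~` F `&` K)%O) in
  cond_values PP F K r /\ lbound (cond_values PP F K) r.
Proof.
move=> AF AK K0 r; have AFK := subalgI bA AF AK.
have AFCK := subalgI bA (subalgC bA AF) AK.
have split_K p : Pj p -> p K = p (F `&` K)%O + p (~` F `&` K)%O.
  move=> /joint_disintegrable[pp _ _].
  by rewrite (fap_split bA pp AK AF) meetC [(K `&` ~` F)%O]meetC.
have pos p : Pj p -> 0 < p K.
  by move=> Pjp; apply: lt_le_trans K0 (lower_joint_le AK Pjp).
have [p [Pjp pX pY _ _]] := extremal_joint AFK AFCK (compl_meet_disjoint F K).
have top_joint P : PP P -> Pj (fun E => P E \top%O).
  by move=> /fcp_disintegrable/disintegrable_joint.
split.
  have [P PPP Pp] := fcp_extension1 (joint_disintegrable Pjp).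
  exists P => //; have pK := pos _ Pjp.
  by rewrite fcp_bayes ?Pp // split_K // pX pY.
move=> _ [P PPP <-].
have Pjt := top_joint _ PPP; have PK := pos _ Pjt.
rewrite fcp_bayes // (split_K _ Pjt) /r -pX -pY.
have pK := pos _ Pjp; rewrite (split_K _ Pjp) in pK.
rewrite (split_K _ Pjt) in PK.
have leX : p (F `&` K)%O <= P (F `&` K)%O \top%O.
  by rewrite pX; apply: lower_joint_le Pjt.
have leY : P (~` F `&` K)%O \top%O <= p (~` F `&` K)%O.
  by rewrite pY; apply: upper_joint_ge Pjt.
have [pp _ _] := joint_disintegrable Pjp.
have [Pp _ _] := fcp_disintegrable PPP.
(* With denominators cleared and the common product cancelled, [leX] and [leY] are multiplied. *)
rewrite ler_pdivrMr // mulrAC ler_pdivlMr // !mulrDr.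
rewrite [X in X + _ <= _]mulrC lerD2l ler_pM // ?(fap_ge0 pp) //.
exact: (fap_ge0 Pp).
Qed.

(** Axiom (C1) gives both [F] and [\top] the value of [K] given [K]. An extension has to be produced
    as well, since the set might otherwise be empty. *)
Lemma cond_values_certain F K : A F -> A K -> K != \bot%O ->
  (F `&` K)%O = K -> cond_values PP F K = [set 1].
Proof.
move=> AF AK K0 FK.
have one P : PP P -> P F K = 1.
  move=> [[P1 P2 _] _ _]; have [_ <- _] := P2 K AK K0.
  by rewrite P1 // FK [RHS]P1 ?meet1x //; apply: subalg1.
apply/seteqP; split=> [_ [P /one + <-] //|_ ->].
have [p [Pjp _ _ _ _]] := extremal_joint (subalg0 bA) (subalg0 bA) (meet0x _).
have [P PPP _] := fcp_extension1 (joint_disintegrable Pjp).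
by exists P => //; apply: one.
Qed.

Lemma cond_values_ge0 F K : A F -> A K -> K != \bot%O ->
  lbound (cond_values PP F K) 0.
Proof. by move=> AF AK K0 _ [P [[_ P2 _] _ _] <-];
  apply: (fap_ge0 (P2 K AK K0)). Qed.

(** * Conditioning events of lower probability zero *)

Lemma null_joint K : A K -> lower Pj K = 0 ->
  exists2 p, disintegrable p & p K = 0.
Proof.
move=> AK K0; have [|p [Pjp pK _ _ _]] := extremal_joint AK (subalg0 bA).
  by rewrite meetx0.
by exists p; [apply: joint_disintegrable|rewrite pK].
Qed.

(** The second layer is the charge at [H i]. If it charges [K], the value is [0] by assumption;
    otherwise a Dirac mass in [H i], inside [K] and outside [F], decides. Its atom lies in no [H k]
    but [H i], which the second layer charges, so the strategy is respected. *)
Lemma null_cond_zero F K i : A F -> A K -> K != \bot%O -> lower Pj K = 0 ->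
  (H i `&` ~` F `&` K)%O != \bot%O -> sigma (F `&` K)%O (H i) = 0 ->
  cond_values PP F K 0.
Proof.
move=> AF AK Kn0 /(null_joint AK)[p pd pK] HFK sFK.
have AFK := subalgI bA AF AK.
have AHFK := subalgI bA (subalgI bA (AH i) (subalgC bA AF)) AK.
have [w [w0 + decw]] := atomic AHFK HFK.
rewrite !lexI => /andP[/andP[wH wF] wK].
have si := strategy_fap i.
have [|k /= wHk|P PPP [_ /(_ F K AF AK Kn0 pK)[P1 P2]]] :=
    fcp_extension pd si (dirac_fap w0 decw).
- move=> F' k AF'; have [<-|ik] := pselect (i = k).
    by rewrite strategy_meet // [sigma (H i) _]strategy_le ?mulr1.
  rewrite (strategy_other ik) mulr0.
  by apply: (fap_null bA si _ _ (leIr _ _) (strategy_other ik)) => //;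
    apply: subalgI.
- right; have [<-|ik] := pselect (i = k); first by rewrite strategy_le ?ltr01.
  have [wk|] := boolP (w <= H k)%O; last by move=> nk;
    rewrite (negPf nk) ltxx in wHk.
  have [_ disH _] := partH; case/eqP: w0; apply/eqP.
  by rewrite -lex0 -(disH _ _ ik) lexI wH.
exists P => //; have [sK|sK] := ltP 0 (sigma K (H i)).
  by rewrite P1 // sFK mul0r.
have {}sK : sigma K (H i) = 0.
  by apply/le_anti; rewrite sK (fap_ge0 si).
rewrite P2 // ?wK ?ltr01 //; have [|_] := boolP (w <= F `&` K)%O;
  last by rewrite mul0r.
rewrite lexI => /andP[wF' _]; case/eqP: w0; apply/eqP.
by rewrite -lex0 -(meetxC F) lexI wF'.
Qed.

(** Take an atom of [K] outside [F] in each [H i] of [index2]. A limit of their Dirac masses is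
    certain of [K] and null on the part in [F]; it is also null on every [H k], which contains at
    most one of these atoms, so the strategy is untouched. *)
Lemma null_cond_infinite F K : A F -> A K -> K != \bot%O -> lower Pj K = 0 ->
  infinite_set (index2 H F K) -> cond_values PP F K 0.
Proof.
move=> AF AK Kn0 /(null_joint AK)[p pd pK] infI2.
have AFK := subalgI bA AF AK.
have /choice[w wP] i : exists w, index2 H F K i ->
    [/\ w != \bot%O, (w <= H i)%O, (w <= ~` F)%O, (w <= K)%O &
      forall y, A y -> decides w y].
  have [[_ HFK]|] := pselect (index2 H F K i); last by exists \bot%O.
  have AHFK := subalgI bA (subalgI bA (AH i) (subalgC bA AF)) AK.
  have [w [w0 + decw]] := atomic AHFK HFK.
  by rewrite !lexI => /andP[/andP[wH wF] wK]; exists w.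
(* Cofinite sets relative to [index2 H F K]; the filter is proper because that set is infinite. *)
pose cofin : set_system I := [set S | finite_set (index2 H F K `\` S)].
have cofinP : ProperFilter cofin.
  apply: Build_ProperFilter_ex => [S fS|].
    apply: contrapT => /forallNP S0; apply: infI2.
    by apply: sub_finite_set fS => i Ii; split=> // /S0.
  split; first by rewrite /cofin /= setDT.
    by move=> S T fS fT; rewrite /cofin /= setDIr finite_setU.
  by move=> S T ST; apply: sub_finite_set => i [Ii Ti]; split=> // /ST.
have near_all (S : set I) : (forall i, index2 H F K i -> S i) ->
  \forall i \near cofin, S i.
  move=> I2S; apply: (@sub_finite_set _ _ set0) => // i [/I2S Si]; exact.
have [|q [qp qP]] := @ultralimit_fap R d B A bA _ cofin
    (fun i x => (w i <= x)%O%:R) cofinP.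
  by apply: near_all => i /wP[w0 _ _ _ decw]; apply: dirac_fap.
have qE x c : A x -> (\forall i \near cofin, (w i <= x)%O%:R = c) -> q x = c.
  move=> Ax xc; have [qle qge] := qP x c Ax; apply/le_anti/andP; split.
    by apply: qle; apply: filterS xc => i ->.
  by apply: qge; apply: filterS xc => i ->.
have qH k : q (H k) = 0.
  apply: qE => //; apply: (@sub_finite_set _ _ [set k]);
    last exact: finite_set1.
  move=> i [/wP[w0 wH _ _ _] wk] /=; apply: contrapT => ik; apply: wk.
  have [wHk|//] := boolP (w i <= H k)%O.
  have [_ disH _] := partH; case/eqP: w0; apply/eqP.
  by rewrite -lex0 -(disH _ _ ik) lexI wH.
have qK : q K = 1.
  by apply: qE => //; apply: near_all => i /wP[_ _ _ -> _].
have qFK : q (F `&` K)%O = 0.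
  apply: qE => //; apply: near_all => i /wP[w0 _ wF _ _].
  have [|//] := boolP (w i <= F `&` K)%O.
  rewrite lexI => /andP[wF' _]; case/eqP: w0; apply/eqP.
  by rewrite -lex0 -(meetxC F) lexI wF'.
have [pp ppiE pdis] := pd.
(* [p] also fills the second layer: being null on [K], it leaves [K] to [q]. *)
have [||P PPP [_ /(_ F K AF AK Kn0 pK)[_ P2]]] := fcp_extension pd pp qp.
- by move=> F' i AF'; rewrite pdis // ppiE.
- by move=> i; rewrite qH ltxx.
- by exists P => //; rewrite P2 // qK ?ltr01 // qFK mul0r.
Qed.

(** The charge at a minimising [H i], used as second layer, attains [r]. Conversely, [index3] being
    empty, finitely many [H i] cover the part of [K] outside [F]; on each of them [P] must give the
    ratio of the strategy, at least [r], and finite additivity combines them. *)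
Lemma null_cond_finite F K : A F -> A K -> K != \bot%O -> lower Pj K = 0 ->
  index2 H F K !=set0 -> index3 H F K = set0 -> finite_set (index2 H F K) ->
  (forall i, index2 H F K i -> 0 < sigma K (H i)) ->
  let r := inf [set sigma (F `&` K)%O (H i) / sigma K (H i) | i in index2 H F
    K] in
  cond_values PP F K r /\ lbound (cond_values PP F K) r.
Proof.
move=> AF AK Kn0 /(null_joint AK)[p pd pK] I2n0 I30 finI2 sK r.
have AFK := subalgI bA AF AK.
have [m [i0 Ii0 mE] rmin] : exists2 m,
    [set sigma (F `&` K)%O (H i) / sigma K (H i) | i in index2 H F K] m &
    lbound [set sigma (F `&` K)%O (H i) / sigma K (H i) | i in index2 H F K] m.
  apply: finite_set_minimum; first exact: finite_image.
  by have [i Ii] := I2n0; eexists; exists i.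
rewrite -mE in rmin.
have rE : r = sigma (F `&` K)%O (H i0) / sigma K (H i0).
  by apply: inf_attained => //; exists i0.
have si := strategy_fap i0; split.
  have [||P PPP [_ /(_ F K AF AK Kn0 pK)[P1 _]]] := fcp_extension pd si si.
  - move=> F' k AF'; have [<-|ik] := pselect (i0 = k).
      by rewrite strategy_meet // [sigma (H i0) _]strategy_le ?mulr1.
    rewrite (strategy_other ik) mulr0.
    by apply: (fap_null bA si _ _ (leIr _ _) (strategy_other ik)) => //;
      apply: subalgI.
  - by move=> k; right.
  - by exists P => //; rewrite P1 ?sK // rE.
move=> _ [P PPP <-]; rewrite rE.
have {}rmin i : index2 H F K i -> r <= sigma (F `&` K)%O (H i) / sigma K (H i).
  by move=> Ii; rewrite rE; apply: rmin; exists i.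
rewrite -rE.
have r1 : r <= 1.
  by rewrite rE ler_pdivrMr ?sK // mul1r (fap_le bA si) // leIr.
have [[P1 P2 P3] _ PH] := PPP.
have PK := P2 K AK Kn0.
have ACF := subalgC bA AF.
have PHi i : index2 H F K i -> P (~` F `&` H i)%O K <= (1 - r) * P (H i) K.
  move=> Ii; have HKn0 : (H i `&` K)%O != \bot%O.
    have [+ _] := Ii; apply: contra => /eqP HK.
    by rewrite meetAC HK meet0x.
  have AHK := subalgI bA (AH i) AK.
  rewrite meetC P3 // mulrC ler_wpM2r ?(fap_ge0 PK) //.
  rewrite (fapC bA (P2 _ AHK HKn0) AF) lerB // (le_trans (rmin _ Ii)) //.
  (* The product rule given [H i] turns the value of [F] given both [H i] and [K] into the ratio of
     the strategy. *)
  have := P3 K F (H i) AK AF (AH i) (partition_neq0 i).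
  rewrite [(K `&` F)%O]meetC [(K `&` H i)%O]meetC => /(_ HKn0);
    rewrite !PH // => ->.
  by rewrite mulrC mulKf // gt_eqF // sK.
have /finite_seqP[s sE] : finite_set [set H i | i in index2 H F K] by exact:
  finite_image.
have sI2 x : x \in s -> exists2 i, index2 H F K i & H i = x.
  move=> xs; have [i Ii <-] : [set H i | i in index2 H F K] x by rewrite sE.
  by exists i.
have AL_join (t : seq B) : {subset t <= s} -> AL (\join_(x <- t) x)%O.
  move=> ts; rewrite big_seq; apply: big_ind => [||x /ts/sI2[i _ <-]] //.
    exact: (subalg0 bAL).
  exact: (subalgU bAL).
have Pjoin (t : seq B) : {subset t <= s} ->
    P (~` F `&` \join_(x <- t) x)%O K <= (1 - r) * P (\join_(x <- t) x)%O K.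
  elim: t => [|x t IH] ts; first by rewrite big_nil meetx0 (fap0 bA PK) mulr0.
  have {}IH : P (~` F `&` \join_(x <- t) x)%O K <= (1 - r) * P (\join_(x <- t)
    x)%O K.
    by apply: IH => z zt; apply: ts; rewrite in_cons zt orbT.
  have ALJ : AL (\join_(x <- t) x)%O.
    by apply: AL_join => z zt; apply: ts; rewrite in_cons zt orbT.
  have [i Ii Hix] := sI2 x (ts _ (mem_head _ _)).
  rewrite big_cons; set J := (\join_(x <- t) x)%O in IH ALJ *.
  have AJ := ALA ALJ; rewrite -Hix.
  (* A repeated event is absorbed by the join; otherwise [H i] is disjoint from [J] and additivity
     applies. *)
  have [/join_idPr->//|HJ] := decH i ALJ.
  have [_ _ PD] := PK; rewrite meetUr !PD //; last 3 first.
  - exact: subalgI.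
  - exact: subalgI.
  - by rewrite meetACA HJ meetx0.
  by rewrite mulrDr lerD // PHi.
have cover : (~` F `&` K <= \join_(x <- s) x)%O.
  rewrite -[X in (_ <= X)%O]complK; apply/meet0P/eqP; apply: contrapT => /negP.
  move=> /(partition_cover partH)[i Hi].
  have HFK : (H i `&` ~` F `&` K)%O != \bot%O.
    apply: contra Hi => /eqP HFK.
    by rewrite !meetA HFK meet0x.
  have Ii : index2 H F K i.
    split=> //; apply/eqP => HFK0.
    by have : index3 H F K i by []; rewrite I30.
  have HiJ : (H i <= \join_(x <- s) x)%O.
    have : [set` s] (H i) by rewrite -sE; exists i.
    by move=> his; apply: (joins_sup_seq id his).
  case/eqP: Hi; rewrite meetCA (_ : (H i `&` ~` _)%O = \bot%O) ?meetx0 //.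
  by apply/meet0P; rewrite complK.
have AJ := ALA (AL_join s (fun _ h => h)).
suff : P (~` F)%O K <= 1 - r.
  by rewrite (fapC bA PK) // lerD2l lerN2.
rewrite P1 //; apply: le_trans (_ : P (~` F `&` \join_(x <- s) x)%O K <= _).
  by apply: (fap_le bA PK); rewrite ?lexI ?leIl ?cover //; apply: subalgI.
apply: le_trans (Pjoin s (fun _ h => h)) _.
by apply: ler_piMr; [rewrite subr_ge0|apply: (fap_le1 bA PK)].
Qed.

(** A member of [index3] has [F] and [K] jointly impossible on its [H i], an infinite [index2] gives
    a limit of Dirac masses, and a member of [index2] with a null charge on [K] allows a point mass.
    Both index sets cannot be empty, as [K] is not contained in [F]. *)
Lemma null_cond F K : A F -> A K -> K != \bot%O -> lower Pj K = 0 ->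
  (F `&` K)%O <> K ->
  ~ [/\ index2 H F K !=set0, index3 H F K = set0, finite_set (index2 H F K)
      & forall i, index2 H F K i -> 0 < sigma K (H i)] ->
  cond_values PP F K 0.
Proof.
move=> AF AK Kn0 pK FK ncond; have AFK := subalgI bA AF AK.
have [I30|/set0P[i [HFK HFCK]]] := eqVneq (index3 H F K) set0; last first.
  apply: (null_cond_zero AF AK Kn0 pK HFCK); apply: strategy_disjoint => //.
  by rewrite meetC meetA.
have [finI2|] := pselect (finite_set (index2 H F K));
  last exact: null_cond_infinite.
have [i Hi] : exists i, (H i `&` (~` F `&` K))%O != \bot%O.
  apply: (partition_cover partH); apply/eqP => /meet0P FCK; apply: FK.
  by apply/meet_idPr; rewrite -leC.
have I2i : index2 H F K i.
  rewrite meetA in Hi; split=> //; apply/eqP => HFK0.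
  by have : index3 H F K i by []; rewrite I30.
have [k Ik /negP sk] : exists2 k, index2 H F K k & ~ (0 < sigma K (H k)).
  apply: contrapT => nok; apply: ncond; split=> // [|k Ik]; first by exists i.
  by apply: contrapT => sk; apply: nok; exists k.
apply: (null_cond_zero AF AK Kn0 pK Ik.2).
have sp := strategy_fap k.
apply: (fap_null bA sp AFK AK (leIr _ _)); apply/le_anti.
by rewrite (fap_ge0 sp) // andbT leNgt.
Qed.

(** * Existence of the minima and maxima *)

Lemma lower_joint_ge0 K : A K -> 0 <= lower Pj K.
Proof.
move=> AK; have [|p [/joint_disintegrable[pp _ _] <- _ _ _]] :=
  extremal_joint AK (subalg0 bA); first by rewrite meetx0.
exact: (fap_ge0 pp).
Qed.

Lemma joint_values_extrema F : A F ->
  has_minimum (values Pj F) /\ has_maximum (values Pj F).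
Proof.
move=> AF; have A0 := subalg0 bA; split.
  have [p [Pjp pF _ lbF _]] := extremal_joint AF A0 (meetx0 F).
  by exists (lower Pj F) => //; exists p.
have [p [Pjp _ pF _ ubF]] := extremal_joint A0 AF (meet0x F).
by exists (upper Pj F) => //; exists p.
Qed.

Lemma cond_values_minimum F K : A F -> A K -> K != \bot%O ->
  has_minimum (cond_values PP F K).
Proof.
move=> AF AK Kn0.
have [FK|FK] := pselect ((F `&` K)%O = K).
  by rewrite cond_values_certain //; exists 1 => // _ ->.
have := lower_joint_ge0 AK; rewrite le_eqVlt => /predU1P[/esym K0|K0].
  have [[I2n0 I30 finI2 sK]|ncond] := pselect [/\ index2 H F K !=set0,
      index3 H F K = set0, finite_set (index2 H F K)
      & forall i, index2 H F K i -> 0 < sigma K (H i)].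
    have [rF rmin] := null_cond_finite AF AK Kn0 K0 I2n0 I30 finI2 sK.
    by eexists; [exact: rF|].
  by exists 0; [apply: null_cond|apply: cond_values_ge0].
by have [rF rmin] := cond_values_positive AF AK K0; eexists; [exact: rF|].
Qed.

End Assessment.

(** * Atoms of the joint algebra and conclusion *)

Lemma generated_star_decides (d : Order.disp_t) (B : ctbDistrLatticeType d)
    (W : Type) (C : W -> B) (G : set B) :
  (forall w w', decides (C w) (C w')) ->
  (forall x, x != \bot%O -> exists w, (C w `&` x)%O != \bot%O) ->
  (forall x w, G x -> decides (C w) x) ->
  forall x w, generated_star G x -> decides (C w) x.
Proof.
move=> decC coverC decG x w; move: w; move: x.
(* Minimality applies because the events decided by all the [C w] form a complete atomic
   subalgebra. *)
suff sG : generated_star G `<=` [set x | forall w, decides (C w) x].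
  by move=> x w /sG.
apply: smallest_sub; first exact: complete_atomic_decides.
by move=> x Gx w; apply: decG.
Qed.

Theorem theorem3 (R : realType) (d : Order.disp_t) (B : ctbDistrLatticeType d)
    (I J : Type) (H : I -> B) (E : J -> B) (AL AE A : set B)
    (sigma : B -> B -> R) (pi : B -> R) :
  @complete_events d B ->
  partition_events H -> partition_events E ->
  boolean_subalgebra AL ->
  generated (range H) `<=` AL -> AL `<=` generated_star (range H) ->
  boolean_subalgebra AE ->
  generated (range E) `<=` AE -> AE `<=` generated_star (range E) ->
  boolean_subalgebra A ->
  generated (AL `|` AE) `<=` A -> A `<=` generated_star (AL `|` AE) ->
  strategy A H sigma ->
  fin_additive_probability AL pi ->
  let PP := fcp_extensions A AL H pi sigma in
  let Pj := joint_probabilities A AL H pi sigma in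
  (* all the minima and maxima are attained *)
  [/\ forall F K, A F -> A K -> K != \bot%O ->
        has_minimum (cond_values PP F K),
      forall F, A F -> has_minimum (values Pj F) /\ has_maximum (values Pj F)
    & forall F K, A F -> A K -> K != \bot%O ->
        has_minimum (L_values Pj F K) /\ has_maximum (U_values Pj F K)] /\
  forall F K, A F -> A K -> K != \bot%O ->
    ((F `&` K)%O = K -> cond_lower PP F K = 1) /\
    ((F `&` K)%O <> K ->
      (0 < lower Pj K ->
        cond_lower PP F K =
        Num.min
          (lower Pj (F `&` K)%O /
             (lower Pj (F `&` K)%O + U_joint Pj (~` F)%O K))
          (L_joint Pj F K /
             (L_joint Pj F K + upper Pj (~` F `&` K)%O))) /\
      (lower Pj K = 0 ->
        let cond := [/\ index2 H F K !=set0, index3 H F K = set0,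
              finite_set (index2 H F K)
            & forall i, index2 H F K i -> 0 < sigma K (H i)] in
        (cond -> cond_lower PP F K =
           inf [set sigma (F `&` K)%O (H i) / sigma K (H i)
                 | i in index2 H F K]) /\
        (~ cond -> cond_lower PP F K = 0))).
Proof.
move=> _ partH partE bAL genAL ALstar bAE genAE AEstar bA genA Astar strat ppi.
move=> PP Pj.
have ALH i : AL (H i) by apply: genAL; apply: sub_gen_smallest; exists i.
have ALA : AL `<=` A.
  by move=> x ALx; apply: genA; apply: sub_gen_smallest; left.
have decL x i : AL x -> decides (H i) x.
  move=> /ALstar; apply: (generated_star_decides (C := H)) =>
    [j k|y|_ k [j _ <-]].
  - exact: partition_decides.
  - exact: partition_cover.
  - exact: partition_decides.
have decE x j : AE x -> decides (E j) x.
  move=> /AEstar; apply: (generated_star_decides (C := E)) =>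
    [k l|y|_ k [l _ <-]].
  - exact: partition_decides.
  - exact: partition_cover.
  - exact: partition_decides.
(* Some of these meets may be [\bot], which decides every event and does no harm. *)
pose C (w : I * J) := (H w.1 `&` E w.2)%O.
have coverC x : x != \bot%O -> exists w, (C w `&` x)%O != \bot%O.
  move=> /(partition_cover partH)[i /(partition_cover partE)[j Hij]].
  by exists (i, j); rewrite /C /= -meetA meetCA.
have decC w w' : decides (C w) (C w').
  have [_ _ _ decI _] := decides_subalgebra (C w).
  apply: decI.
    by apply: decides_le (leIl _ _) _; apply: partition_decides.
  by apply: decides_le (leIr _ _) _; apply: partition_decides.
have decA x w : A x -> decides (C w) x.
  move=> /Astar; apply: (generated_star_decides decC coverC) =>
    y v [/decL|/decE] dy.
    exact: decides_le (leIl _ _) (dy _).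
  exact: decides_le (leIr _ _) (dy _).
have atomic x : A x -> x != \bot%O -> exists w,
    [/\ w != \bot%O, (w <= x)%O & forall y, A y -> decides w y].
  move=> Ax x0; have [w Cwx] := coverC _ x0; exists (C w); split.
  - by apply: contra Cwx => /eqP->; rewrite meet0x.
  - by have [//|Cx] := decA _ w Ax; rewrite Cx eqxx in Cwx.
  - by move=> y; apply: decA.
split; [split|].
- by move=> F K AF AK Kn0; apply: cond_values_minimum.
- by move=> F AF; apply: joint_values_extrema.
- move=> F K AF AK _; split.
    by have [] := L_joint_attained partH bAL bA ALA ALH decL atomic strat ppi
      AF AK;
      exists (lower Pj (F `&` K)%O).
  by have [] := U_joint_attained partH bAL bA ALA ALH decL atomic strat ppi AF
    AK;
    exists (upper Pj (F `&` K)%O).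
move=> F K AF AK Kn0; split=> [FK|FK].
  rewrite /cond_lower cond_values_certain //; exact: inf1.
split=> [K0|K0 cond].
  (* Both constrained envelopes reduce to unconstrained ones, so the two fractions are equal. *)
  have -> : U_joint Pj (~` F)%O K = upper Pj (~` F `&` K)%O.
    by apply: sup_attained; apply U_joint_attained => //; apply: subalgC.
  have -> : L_joint Pj F K = lower Pj (F `&` K)%O.
    by apply: inf_attained; apply L_joint_attained.
  by rewrite minxx; apply: inf_attained; apply cond_values_positive.
split=> [[I2n0 I30 finI2 sK]|ncond].
  by apply: inf_attained; apply null_cond_finite.
by apply: inf_attained; [apply: null_cond|apply: cond_values_ge0].
Qed.
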